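(* Let $K$ be an algebraically closed field of characteristic zero, $R=K[x_1,\dots,x_n]$, and $S=K[X_1,\dots,X_n]$ the divided power algebra viewed as an $R$-module via contraction. Let $F\in S$ be a homogeneous binomial (a sum of two monomials with nonzero coefficients) such that $A_F=R/\operatorname{Ann}_R(F)$ is an Artinian complete intersection $K$-algebra of codimension $n$. Then $A_F$ satisfies the strong Lefschetz property.
   Context: The contraction action is $x_i\circ X_j^k=\delta_{ij}X_j^{k-1}$ if $k>0$ and $0$ otherwise, extended linearly; $\operatorname{Ann}_R(F)=\{f\in R\mid f\circ F=0\}$ and $F$ is called the Macaulay dual generator of $A_F$. A graded Artinian $K$-algebra $A$ has the strong Lefschetz property if there is a linear form $\ell\in A_1$ such that for all integers $i\ge 0$ and $k\ge 1$ the multiplication map $\times\ell^k:A_i\to A_{i+k}$ has maximal rank (is injective or surjective). *)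

(* Defs.v *)
From HB Require Import structures.
From mathcomp Require Import all_boot all_order all_algebra.
From mathcomp Require Export mpoly.
Set Implicit Arguments. Unset Strict Implicit. Unset Printing Implicit Defensive.
Import Order.TTheory GRing.Theory.
Local Open Scope ring_scope.

(* R = K[x_1..x_n] and the divided power algebra S = K[X_1..X_n] are both
   represented by {mpoly K[n]}: an element of S is written in the divided-power
   monomial basis X^[a], encoded by the monomial 'X_[a].  Only the K-vector
   space structure of S and the contraction action of R on S are used. *)

Definition contract (K : fieldType) (n : nat) (f F : {mpoly K[n]}) : {mpoly K[n]} :=
  \sum_(b <- msupp f) \sum_(a <- msupp F)
     (f@_b * F@_a) *: (if (b <= a)%MM then 'X_[(a - b)%MM] else 0).

Definition Ann (K : fieldType) (n : nat) (F : {mpoly K[n]}) (f : {mpoly K[n]}) : Prop :=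
  contract f F = 0.

Definition generated_by (K : fieldType) (n : nat) (I : {mpoly K[n]} -> Prop)
    (g : 'I_n -> {mpoly K[n]}) : Prop :=
  forall f, I f <-> exists c : 'I_n -> {mpoly K[n]}, f = \sum_(i < n) c i * g i.

(* A = R/I is an Artinian complete intersection of codimension n
   (I generated by a regular sequence of length n = number of variables;
   in R such an ideal is exactly an ideal generated by n elements with R/I
   Artinian).  For I = Ann_R(F), R/I is automatically Artinian, but we state
   Artinianity explicitly: every variable is nilpotent modulo I. *)
Definition artinian_CI_codim_n (K : fieldType) (n : nat) (I : {mpoly K[n]} -> Prop) : Prop :=
  (exists g : 'I_n -> {mpoly K[n]}, generated_by I g) /\
  (forall i : 'I_n, exists e : nat, I ('X_i ^+ e)).

(* Strong Lefschetz property for the graded algebra A = R/I, I a homogeneous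
   ideal, with A_i = R_i / (I cap R_i).  A linear form l in A_1 is the class of
   a linear form of R; multiplication by l^k : A_i -> A_{i+k} has maximal rank
   iff it is injective or surjective. *)
Definition strong_Lefschetz_quot (K : fieldType) (n : nat) (I : {mpoly K[n]} -> Prop) : Prop :=
  exists l : {mpoly K[n]}, l \is 1.-homog /\
    forall i k : nat, (1 <= k)%N ->
      (forall f : {mpoly K[n]}, f \is i.-homog -> I (l ^+ k * f) -> I f)
      \/
      (forall h : {mpoly K[n]}, h \is (i + k)%N.-homog ->
         exists f : {mpoly K[n]}, f \is i.-homog /\ I (h - l ^+ k * f)).

(* Main.v *)
Require Import Defs.
From Stdlib Require Import Classical_Prop.
From HB Require Import structures.
From mathcomp Require Import all_boot all_order all_algebra.
From mathcomp Require Import mpoly.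
From mathcomp Require Import ring zify.
Set Implicit Arguments. Unset Strict Implicit. Unset Printing Implicit Defensive.
Import GRing.Theory.
Local Open Scope ring_scope.

(** Write F = c1 X^a + c2 X^b and I = Ann F, with socle degree d = |a|. By
    Gorenstein duality it is enough that, for some linear form l,
    multiplication by l^(d-2i) from degree i to degree d-i is surjective for
    2i <= d.

    In two variables this holds for the annihilator of any form: in degrees
    where I vanishes the higher Hessian is a Wronskian, and from the initial
    degree of I on, multiplication by a generic linear form is surjective.
    The property survives adjoining a variable x with x^(e+1) in I: split into
    strings generated by primitive elements, on each of which K[y, x] acts
    through a monomial complete intersection in two variables.

    Let P = {k | a_k > b_k} and Q = {k | b_k > a_k}. If P and Q are singletons,
    start from these two variables and adjoin the others. Otherwise let
    |Q| >= 2, up to exchanging a and b, and let i be in P. All the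
    x_k^(max(a_k,b_k)+1) with k <> i are minimal generators of I, so that one
    generator is left, and comparing socles shows that I contains a form in
    which x_i^(b_i+1) occurs; this forces P = {i}. Then I degenerates to a
    monomial complete intersection of the same socle degree when the variables
    other than x_i are rescaled, and surjectivity is an open condition. *)

(** * Generic parameters and the Wronskian *)

(** The parameter ranges over a nonempty Zariski open subset of the line; with an explicit nonzero
    polynomial, finite intersections become products. *)
Definition generically (K : fieldType) (P : K -> Prop) : Prop :=
  exists2 D : {poly K}, D != 0 & forall t, D.[t] != 0 -> P t.

Lemma row_neq0 (R : nmodType) n (u : 'rV[R]_n) : u != 0 ->
  exists l, u 0 l != 0.
Proof.
move=> u0; apply/existsP; apply: contraNT u0 => /existsPn W.
by apply/eqP/rowP => l; rewrite mxE; apply/eqP; have := W l; rewrite negbK.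
Qed.

Section Generic.
Variable K : fieldType.
Implicit Types P Q : K -> Prop.

Lemma genericallyW P Q : (forall t, P t -> Q t) ->
  generically P -> generically Q.
Proof. by move=> PQ [D D0 DP]; exists D => // t /DP /PQ. Qed.

Lemma generically_true P : (forall t, P t) -> generically P.
Proof. by move=> PT; exists 1; rewrite ?oner_neq0. Qed.

Lemma generically_and P Q : generically P -> generically Q ->
  generically (fun t => P t /\ Q t).
Proof.
move=> [D D0 DP] [E E0 EQ]; exists (D * E); first by rewrite mulf_neq0.
by move=> t; rewrite hornerM mulf_eq0 negb_or => /andP[/DP ? /EQ].
Qed.

Lemma generically_all (P : nat -> K -> Prop) N :
  (forall i, (i < N)%N -> generically (P i)) ->
  generically (fun t => forall i, (i < N)%N -> P i t).
Proof.
elim: N => [_|N IH gP]; first exact: generically_true.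
have := generically_and (IH (fun i iN => gP i (ltnW iN))) (gP N (ltnSn N)).
apply: genericallyW => t [lt eqN] i; rewrite ltnS leq_eqVlt.
by case/predU1P=> [->//|/lt].
Qed.

Lemma generically_nonroot (D : {poly K}) : D != 0 ->
  generically (fun t => D.[t] != 0).
Proof. by move=> D0; exists D. Qed.

Lemma generically_neq0 : generically (fun t : K => t != 0).
Proof. by exists 'X; rewrite ?polyX_eq0 // => t; rewrite hornerX. Qed.

Hypothesis charK : [pchar K] =i pred0.

Lemma natr_inj_char0 : injective (fun n : nat => n%:R : K).
Proof.
move=> m n /= mn; have natr_eq0 := (pcharf0P K).1 charK.
wlog le_mn : m n mn / (m <= n)%N.
  by move=> W; case/orP: (leq_total m n) => /W; [|move=> <-]; auto.
apply/eqP; rewrite eqn_leq le_mn -subn_eq0 -natr_eq0 natrB // mn subrr.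
by apply/eqP.
Qed.

Lemma generically_ex P : generically P -> exists t, P t.
Proof.
case=> D D0 DP.
have [/allP rD|/allPn[t _ /DP Pt]] :=
  boolP (all (root D) [seq n%:R | n <- iota 0 (size D)]); last by exists t.
have := @max_poly_roots K D [seq n%:R | n <- iota 0 (size D)] D0.
rewrite map_inj_uniq ?iota_uniq ?size_map ?size_iota ?ltnn; last first.
  exact: natr_inj_char0.
by move=> W; have : false by apply: W => //; apply/allP.
Qed.

(** Vandermonde argument: on a support of at most [r] points, a polynomial of degree less than [r]
    vanishing at all of them but [l0] would isolate [c l0]. *)
Lemma power_sum_support m r (c : 'I_m -> K) :
  (forall k, (k < r)%N -> \sum_l c l * (l : nat)%:R ^+ k = 0) ->
  (exists l, c l != 0) -> (r < #|[set l | c l != 0%R]|)%N.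
Proof.
move=> sum0 [l0 cl0]; rewrite ltnNge; apply/negP => leSr.
set S := [set l | c l != 0] in leSr.
pose p : {poly K} := \prod_(l in S :\ l0) ('X - (l : nat)%:R%:P).
have szp : (size p <= r)%N.
  rewrite /p -big_enum size_prod_XsubC -cardE; apply: leq_trans leSr.
  by rewrite (cardsD1 l0 S) inE cl0.
have : \sum_l c l * p.[(l : nat)%:R] = 0.
  under eq_bigr do rewrite horner_coef mulr_sumr.
  rewrite exchange_big big1 //= => k _.
  under eq_bigr do rewrite mulrCA.
  by rewrite -mulr_sumr sum0 ?mulr0 // (leq_trans (ltn_ord k)).
rewrite (bigD1 l0) //= big1 ?addr0 => [|l nl].
  move/eqP; rewrite mulf_eq0 (negPf cl0) /=; apply/negP.
  rewrite horner_prod prodf_seq_neq0; apply/allP => l _; apply/implyP.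
  rewrite !inE => /andP[nl _]; rewrite hornerXsubC subr_eq0.
  by apply: contraNneq nl => /natr_inj_char0 /val_inj ->.
have [->|cl] := eqVneq (c l) 0; first by rewrite mul0r.
by rewrite horner_prod (bigD1 l) ?inE ?nl //= hornerXsubC subrr mul0r mulr0.
Qed.

(* The Wronskian of linearly independent polynomials does not vanish, with
   the Euler operator X d/dX in place of the derivation. In a vanishing
   combination, the coefficients of lowest order in t would be supported on
   more than r columns (Vandermonde), and would give as many echelon vectors
   in the row space of M. *)
Lemma generically_wronskian r m (M : 'M[K]_(r, m)) : row_free M ->
  generically (fun t => M *m (\matrix_(l < m, k < r)
     (t ^+ l * (l : nat)%:R ^+ k)) \in unitmx).
Proof.
move=> freeM.
pose L : 'M[{poly K}]_(m, r) := \matrix_(l, k) ('X^l * ((l : nat)%:R ^+ k)%:P).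
pose A := map_mx polyC M *m L.
have evA t : map_mx (horner_eval t) A =
    M *m (\matrix_(l < m, k < r) (t ^+ l * (l : nat)%:R ^+ k)).
  rewrite map_mxM; congr (_ *m _).
    by apply/matrixP => i j; rewrite !mxE /= /horner_eval hornerC.
  by apply/matrixP => i j; rewrite !mxE /= /horner_eval hornerM hornerXn hornerC.
exists (\det A) => [|t]; last first.
  by rewrite unitmxE unitfE -evA det_map_mx.
apply/negP => /det0P[v v0 vA0].
have [w defw] : exists w, w = v *m map_mx polyC M by eexists.
have wL : w *m L = 0 by rewrite defw -mulmxA.
have [B MB] := row_freeP freeM.
have w0 : w != 0.
  apply: contra_neq v0 => w0; have : w *m map_mx polyC B = 0.
    by rewrite w0 mul0mx.
  by rewrite defw -mulmxA -map_mxM MB map_mx1 mulmx1.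
pose q (l : 'I_m) := w 0 l * 'X^l.
have exq : exists j, [exists l, (q l)`_j != 0].
  have [l wl] := row_neq0 w0.
  exists ((size (w ord0 l)).-1 + l)%N; apply/existsP; exists l.
  by rewrite /q coefMXn ltnNge leq_addl /= addnK -lead_coefE lead_coef_eq0.
pose mu := ex_minn exq.
have [/existsP[l1 ql1] minmu] : ([exists l, (q l)`_mu != 0] : Prop) /\
    (forall j l, (j < mu)%N -> (q l)`_j = 0).
  rewrite /mu; case: ex_minnP => j0 ? min; split=> // j l; rewrite ltnNge.
  by apply: contraNeq => qlj; apply: min; apply/existsP; exists l.
pose a l := (q l)`_mu; pose S := [set l | a l != 0].
have cardS : (r < #|S|)%N.
  apply: power_sum_support; last by exists l1.
  move=> k kr; have := congr1 (fun B : 'rV[{poly K}]_r => (B 0 (Ordinal kr))`_mu) wL.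
  rewrite !mxE coef0 coef_sum => wk; rewrite -[RHS]wk; apply: eq_bigr => l _.
  by rewrite mxE mulrA coefMC.
pose pos (s : 'I_#|S|) : 'I_m := enum_val s.
(* There are more than [r] rows, hence a relation [u]. But row [s] of [C *m M] is nonzero in column
   [pos s] and, by minimality of [mu], zero in all earlier columns, which is contradicted at the
   first column used by [u]. *)
pose C : 'M[K]_(#|S|, r) := \matrix_(s, b) (v 0 b)`_(mu - pos s).
have : ~~ row_free C by rewrite /row_free neq_ltn (leq_ltn_trans (rank_leq_col C)).
rewrite -kermx_eq0 => /rowV0Pn[u /sub_kermxP uC u0].
have [s0 us0] := row_neq0 u0.
case: (@arg_minnP _ s0 (fun s => u 0 s != 0) (fun s => pos s : nat) us0) => s1 us1 mins1.
have wE s l : (C *m M) s l = (w 0 l)`_(mu - pos s).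
  by rewrite defw !mxE coef_sum; apply: eq_bigr => b _; rewrite !mxE coefMC.
have nz s : a (pos s) != 0 by have := enum_valP s; rewrite inE.
have le_mu s : (pos s <= mu)%N.
  by rewrite leqNgt; have := nz s; apply: contra => lt; rewrite /a /q coefMXn lt.
have := congr1 (mulmx^~ M) uC; rewrite /= mul0mx -mulmxA.
move/(congr1 (fun B : 'rV_m => B 0 (pos s1))); rewrite mxE [RHS]mxE.
rewrite (bigD1 s1) //= big1 ?addr0 => [|s ns].
  move/eqP; rewrite wE mulf_eq0 (negPf us1) /=; apply/negP.
  by have := nz s1; rewrite /a /q coefMXn ltnNge le_mu.
have [->|us] := eqVneq (u 0 s) 0; first by rewrite mul0r.
have lts : (pos s1 < pos s)%N.
  rewrite ltn_neqAle mins1 // andbT; apply: contra ns => /eqP/val_inj/enum_val_inj.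
  by move->.
have ltmu : (mu - pos s + pos s1 < mu)%N by have := le_mu s; lia.
have := minmu _ (pos s1) ltmu.
by rewrite wE /q coefMXn ltnNge leq_addl /= addnK => ->; rewrite mulr0.
Qed.
End Generic.

(** * Binary forms *)

Section BinaryForms.
Variable K : fieldType.
Implicit Types (phi : nat -> K) (f g h p q : {poly K}).

(* The functional on binary forms of degree d with moments phi, a form of
   degree m in y and z being represented by its dehomogenization at y = 1
   together with the bound m on its degree. *)
Definition moment_functional d phi q : K := \sum_(l < d.+1) phi l * q`_l.
Local Notation fnl := moment_functional.

Fact moment_functional_linear d phi : linear_for *%R (fnl d phi).
Proof.
move=> c p q; rewrite /fnl mulr_sumr -big_split /=; apply: eq_bigr => l _.
by rewrite coefD coefZ; ring.
Qed.
HB.instance Definition _ d phi := GRing.isLinear.Build K {poly K} K *%R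
  (fnl d phi) (@moment_functional_linear d phi).

Lemma moment_functionalXn d phi j : (j <= d)%N -> fnl d phi 'X^j = phi j.
Proof.
move=> jd; rewrite /fnl (bigD1 (Ordinal (jd : (j < d.+1)%N))) //= coefXn eqxx.
rewrite mulr1 big1 ?addr0 // => l; rewrite -val_eqE /= coefXn => /negPf ->.
exact: mulr0.
Qed.

Definition catalecticant i e phi : 'M[K]_(i.+1, e.+1) :=
  \matrix_(j, l) phi (j + l)%N.

Lemma poly_sumXn n p : (size p <= n)%N -> p = \sum_(l < n) p`_l *: 'X^l.
Proof.
move=> sp; rewrite -poly_def; apply/polyP => l; rewrite coef_poly.
by case: ltnP => // nl; rewrite nth_default // (leq_trans sp).
Qed.

Lemma moment_functionalM i e phi f g :
  (size f <= i.+1)%N -> (size g <= e.+1)%N ->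
  fnl (i + e) phi (f * g) =
  \sum_l (poly_rV f *m catalecticant i e phi) 0 l * g`_l.
Proof.
move=> sf sg; rewrite {1}(poly_sumXn sf) {1}(poly_sumXn sg) mulr_suml linear_sum.
under [RHS]eq_bigr do rewrite mxE mulr_suml.
rewrite [RHS]exchange_big /=; apply: eq_bigr => j _.
rewrite mulr_sumr linear_sum; apply: eq_bigr => l _ /=.
rewrite -scalerAl -scalerAr !linearZ /= -exprD moment_functionalXn; last first.
  by rewrite leq_add // -ltnS.
by rewrite !mxE; ring.
Qed.

Lemma size_linear (t : K) : (size (1 + t *: 'X : {poly K})%R <= 2)%N.
Proof.
apply: leq_trans (size_polyD _ _) _; rewrite geq_max size_poly1.
by rewrite (leq_trans (size_scale_leq _ _)) // size_polyX.
Qed.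

Lemma size_linearX (t : K) N : (size ((1 + t *: 'X : {poly K}) ^+ N)%R <= N.+1)%N.
Proof.
apply: leq_trans (size_poly_exp_leq _ _) _.
rewrite ltnS -[leqRHS]mul1n leq_mul2r; apply/orP; right.
by have := size_linear t; lia.
Qed.

Lemma size_linearXM (t : K) N (c : {poly K}) i : (size c <= i.+1)%N ->
  (size ((1 + t *: 'X) ^+ N * c)%R <= (N + i).+1)%N.
Proof.
move=> sc; apply: leq_trans (size_polyMleq _ _) _; rewrite -subn1 leq_subLR.
by apply: leq_trans (leq_add (size_linearX t N) sc) _; rewrite addSn addnS.
Qed.

(** The left side is the Euler operator applied [k] times to [(1 + t X)^N], and each application
    costs at most one factor [1 + t X]. This links the columns of the Wronskian matrix to powers of
    a linear form. *)
Lemma euler_power (t : K) N k : (k <= N)%N ->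
  exists2 g : {poly K}, (size g <= k.+1)%N &
    \poly_(l < N.+1) (t ^+ l * l%:R ^+ k *+ 'C(N, l)) =
    (1 + t *: 'X) ^+ (N - k) * g.
Proof.
elim: k => [_|k IH ltkN].
  exists 1; first by rewrite size_poly1.
  rewrite subn0 mulr1 exprDn poly_def; apply: eq_bigr => l _.
  by rewrite expr1n mul1r exprZn expr0 mulr1 scalerMnl.
have [g sg Eg] := IH (ltnW ltkN).
exists (((N - k)%:R * t) *: ('X * g) + (1 + t *: 'X) * ('X * g^`())).
  apply: leq_trans (size_polyD _ _) _; rewrite geq_max.
  rewrite (leq_trans (size_scale_leq _ _)) /=; last first.
    by rewrite -commr_polyX (leq_trans (size_polyMleq _ _)) // size_polyX addn2.
  have sg' : (size g^`() <= k)%N.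
    have [->|g0] := eqVneq g 0; first by rewrite deriv0 size_poly0.
    by rewrite -ltnS (leq_trans (lt_size_deriv g0)).
  have s1 := size_linear t.
  have sX : (size ('X * g^`())%R <= k.+1)%N.
    by rewrite (leq_trans (size_polyMleq _ _)) // size_polyX.
  by rewrite (leq_trans (size_polyMleq _ _)) //; lia.
transitivity ('X * (\poly_(l < N.+1) (t ^+ l * l%:R ^+ k *+ 'C(N, l)))^`()).
  apply/polyP => l; rewrite coefXM coef_deriv !coef_poly.
  case: l => [|l] /=; first by rewrite expr0n /= mulr0 mul0rn.
  case: ltnP => _; last by rewrite mul0rn.
  by rewrite [_%:R ^+ k.+1]exprSr mulrA mulr_natr mulrnAC.
have dP : (1 + t *: 'X : {poly K})^`() = t%:P.
  by rewrite derivD derivZ derivX -[1]/(1%:P) derivC add0r -mul_polyC mulr1.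
have eN : (N - k)%N = (N - k.+1).+1 by rewrite subnSK.
rewrite Eg eN; move: (N - k.+1)%N => m.
rewrite derivM deriv_exp dP /= -[(_ * t) *: _]mul_polyC polyCM polyC_natr.
rewrite -[_ *+ m.+1]mulr_natr exprS.
move: (1 + t *: 'X) g^`() => P g'.
ring.
Qed.

(** Since [g] does not vanish at the root of [1 + t X], subtracting a constant multiple of [g] makes
    [q] divisible by [1 + t X]; this is repeated [N] times. *)
Lemma poly_division_iter (t : K) g i : t != 0 -> g.[- t^-1] != 0 ->
  (size g <= i.+1)%N -> forall N q, (size q <= N + i.+1)%N ->
  exists c h : {poly K}, [/\ (size c <= i.+1)%N, (size h <= N)%N &
                  q = (1 + t *: 'X) ^+ N * c + h * g].
Proof.
move=> t0 gt sg; elim=> [|N IH] q sq.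
  by exists q, 0; rewrite size_poly0 expr0 mul1r mul0r addr0; split.
pose c := q.[- t^-1] / g.[- t^-1].
have /factor_theorem[q1 Eq1] : root (q - c%:P * g) (- t^-1).
  by rewrite rootE !hornerE /c divfK // subrr.
have Xt : 'X - (- t^-1)%:P = t^-1 *: (1 + t *: 'X) :> {poly K}.
  by rewrite scalerDr scalerA mulVf // scale1r polyCN opprK addrC alg_polyC.
have s1 : (size q1 <= N + i.+1)%N.
  have [->|q10] := eqVneq q1 0; first by rewrite size_poly0.
  have : (size (q - c%:P * g)%R <= N.+1 + i.+1)%N.
    apply: leq_trans (size_polyD _ _) _; rewrite geq_max sq size_polyN.
    rewrite mul_polyC (leq_trans (size_scale_leq _ _)) //.
    by rewrite (leq_trans sg) // leq_addl.
  by rewrite Eq1 size_Mmonic ?monicXsubC // size_XsubC addn2.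
have [c' [h [sc sh Eq]]] := IH (t^-1 *: q1) (leq_trans (size_scale_leq _ _) s1).
exists c', ((1 + t *: 'X) * h + c%:P); split=> //.
  have sP := size_linear t.
  apply: leq_trans (size_polyD _ _) _; rewrite geq_max.
  rewrite (leq_trans (size_polyMleq _ _)) ?(leq_trans (size_polyC_leq1 _)) //.
  by lia.
rewrite -[q](subrK (c%:P * g)) Eq1 Xt -scalerAr scalerAl Eq.
by rewrite exprS; ring.
Qed.

Hypothesis charK : [pchar K] =i pred0.

(* For forms of degree i: when the catalecticant is nonsingular, the higher
   Hessian is the Wronskian of its rows; otherwise, a form annihilated in
   degree i cuts the quotient down so that multiplication by a generic linear
   form is surjective from degree i on. *)
Lemma generically_binary_Lefschetz_at phi d i : (i.*2 <= d)%N ->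
  generically (fun t : K => forall q, (size q <= (d - i).+1)%N ->
    exists2 c : {poly K}, (size c <= i.+1)%N &
      forall h, (size h <= i.+1)%N ->
      fnl d phi ((q - (1 + t *: 'X) ^+ (d - i.*2) * c) * h) = 0).
Proof.
move=> id.
have [N Ed] : exists N, d = (N + i.*2)%N by exists (d - i.*2)%N; lia.
have -> : (d - i.*2)%N = N by lia.
have Ee : (d - i)%N = (N + i)%N by lia.
have Edi : d = (i + (N + i))%N by lia.
rewrite {}Ee; rewrite {}Edi in id Ed *.
have [free|] := boolP (row_free (catalecticant i (N + i) phi)); last first.
  rewrite -kermx_eq0 => /rowV0Pn[u /sub_kermxP uC u0].
  pose g := rVpoly u.
  have sg : (size g <= i.+1)%N by apply: size_poly.
  have [l ul] := row_neq0 u0.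
  (* The signed reversal of [g]: [G.[t]] equals [t ^+ i * g.[- t^-1]], so that generically the root
     of [1 + t X] is not a root of [g]. *)
  pose G : {poly K} := \poly_(k < i.+1) ((-1) ^+ (i - k) * g`_(i - k)).
  have G0 : G != 0.
    apply/eqP => /(congr1 (fun p : {poly K} => p`_(i - l))).
    rewrite coef0 coef_poly ltnS leq_subr subKn -1?ltnS //.
    rewrite coef_rVpoly_ord => /eqP.
    by rewrite mulf_eq0 signr_eq0 (negPf ul).
  have := generically_and (generically_neq0 K) (generically_nonroot G0).
  apply: genericallyW => t [t0 Gt] q sq.
  have gt : g.[- t^-1] != 0.
    apply: contra Gt => /eqP gt; have : t ^+ i * g.[- t^-1] = 0 by rewrite gt mulr0.
    rewrite (horner_coef_wide _ sg) horner_poly mulr_sumr => sum0.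
    rewrite -[X in _ == X]sum0; apply/eqP.
    rewrite (reindex_inj rev_ord_inj) /=; apply: eq_bigr => k _.
    have ki : (k <= i)%N by rewrite -ltnS.
    have tE : t ^+ i = t ^+ (i - k) * t ^+ k by rewrite -exprD subnK.
    have tk : t ^+ k != 0 by rewrite expf_neq0.
    rewrite subSS subKn // tE [(- t^-1) ^+ k]exprNn exprVn.
    by move: ((-1) ^+ k) (t ^+ (i - k)) => e x; field.
  have [c [h [sc sh Eq]]] := poly_division_iter t0 gt sg
    (leq_trans sq (eq_leq (esym (addnS _ _)))).
  exists c => // h' sh'; rewrite Eq addrAC subrr add0r.
  rewrite (mulrC h) -mulrA moment_functionalM //; last first.
    by rewrite (leq_trans (size_polyMleq _ _)) //; lia.
  by rewrite /g rVpolyK uC big1 // => k _; rewrite mxE mul0r.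
(* The binomial weights, invertible in characteristic zero, turn the columns of the Wronskian matrix
   into the polynomials of [euler_power] with exponent [N + i]. *)
pose D := diag_mx (\row_(l < (N + i).+1) ('C(N + i, l))%:R : 'rV[K]__).
have freeD : row_free (catalecticant i (N + i) phi *m D).
  have [B CB] := row_freeP free.
  pose E := diag_mx (\row_(l < (N + i).+1) ('C(N + i, l))%:R^-1 : 'rV[K]__).
  have DE : D *m E = 1%:M.
    rewrite /D /E mulmx_diag -diag_const_mx; congr diag_mx.
    apply/rowP => l; rewrite !mxE divff // ((pcharf0P K).1 charK).
    by rewrite -lt0n bin_gt0 -ltnS.
  by apply/row_freeP; exists (E *m B); rewrite -mulmxA (mulmxA D) DE mul1mx.
apply: genericallyW (generically_wronskian charK freeD) => t unitW q sq.
(* The higher Hessian. A vector in its kernel kills the multiples of [(1 + t X)^N], among them the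
   Euler iterates of [(1 + t X)^(N + i)] of order at most [i], so it also kills the invertible
   Wronskian matrix. *)
pose Q : 'M[K]_i.+1 :=
  \matrix_(j, k) fnl (i + (N + i)) phi ('X^j * ((1 + t *: 'X) ^+ N * 'X^k)).
have QE u v : (u *m Q *m v^T) 0 0 =
    fnl (i + (N + i)) phi (rVpoly u * ((1 + t *: 'X) ^+ N * rVpoly v)).
  rewrite !mxE [in RHS](poly_sumXn (size_poly _ _ : (size (rVpoly v) <= i.+1)%N)).
  rewrite !mulr_sumr linear_sum; apply: eq_bigr => k _.
  rewrite mxE coef_rVpoly_ord.
  rewrite [in RHS](poly_sumXn (size_poly _ _ : (size (rVpoly u) <= i.+1)%N)).
  rewrite [in RHS]mulr_suml linear_sum mulr_suml; apply: eq_bigr => j _ /=.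
  rewrite !mxE coef_rVpoly_ord -scalerAl -!scalerAr !linearZ /= -mulrA.
  by rewrite (mulrC _ (v _ _)).
have unitQ : Q \in unitmx.
  rewrite -row_free_unit; apply: inj_row_free => u uQ.
  set W := (_ *m _ *m _) in unitW.
  suff uW : u *m W = 0 by rewrite -[u](mulmxK unitW) uW mul0mx.
  apply/rowP => k; rewrite [RHS]mxE.
  have kN : (k <= N + i)%N by have := ltn_ord k; lia.
  have [g sg Eg] := euler_power t kN.
  pose h := (1 + t *: 'X) ^+ (i - k) * g.
  have sh : (size h <= i.+1)%N.
    apply: leq_trans (size_linearXM _ _ sg) _.
    by have := ltn_ord k; lia.
  have := QE u (poly_rV h); rewrite uQ mul0mx mxE poly_rV_K //.
  rewrite /h mulrA -exprD addnBA -1?ltnS // -Eg.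
  rewrite moment_functionalM ?size_poly // rVpolyK => uE; rewrite [RHS]uE.
  rewrite /W !mulmxA mxE; apply: eq_bigr => l _.
  by rewrite mul_mx_diag !mxE coef_poly ltn_ord -[in RHS]mulr_natr; ring.
pose b : 'rV[K]_i.+1 := \row_j fnl (i + (N + i)) phi ('X^j * q).
pose v := b *m (invmx Q)^T.
exists (rVpoly v) => [|h sh]; first exact: size_poly.
rewrite mulrC mulrBr linearB /=; apply/eqP; rewrite subr_eq0; apply/eqP.
rewrite -{2}(poly_rV_K sh) -QE trmx_mul trmxK mulmxA mulmxK //.
rewrite {1}(poly_sumXn sh) mulr_suml linear_sum mxE.
apply: eq_bigr => j _; rewrite -scalerAl linearZ /= !mxE.
by [].
Qed.

Lemma generically_binary_Lefschetz phi d :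
  generically (fun t : K => forall i q, (i.*2 <= d)%N ->
    (size q <= (d - i).+1)%N ->
    exists2 c : {poly K}, (size c <= i.+1)%N &
      forall h, (size h <= i.+1)%N ->
      fnl d phi ((q - (1 + t *: 'X) ^+ (d - i.*2) * c) * h) = 0).
Proof.
pose P i t := (i.*2 <= d)%N -> forall q, (size q <= (d - i).+1)%N ->
    exists2 c : {poly K}, (size c <= i.+1)%N &
      forall h, (size h <= i.+1)%N ->
      fnl d phi ((q - (1 + t *: 'X) ^+ (d - i.*2) * c) * h) = 0.
have gP i : (i < d.+1)%N -> generically (P i).
  move=> _; case: (leqP i.*2 d) => id.
    by apply: genericallyW (generically_binary_Lefschetz_at phi id) => t Pt _.
  by apply: generically_true => t; rewrite /P leqNgt id.
apply: genericallyW (generically_all gP) => t Pt i q id.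
by apply: Pt => //; lia.
Qed.
End BinaryForms.

(** * Forms, ideals and primitive decomposition *)

Section Forms.
Variables (K : fieldType) (n : nat).
Implicit Types (f g h p l y z : {mpoly K[n]}) (S : {set 'I_n}) (m : 'X_{1..n}).

(** [y] and [z] are arbitrary polynomials, not only variables, so that the binary result can be
    applied with a linear form [l] in place of [y]. *)
Definition homogenization M y z (q : {poly K}) : {mpoly K[n]} :=
  \sum_(r < M.+1) q`_r *: (y ^+ (M - r) * z ^+ r).

Fact homogenization_linear M y z : linear (homogenization M y z).
Proof.
move=> c p q; rewrite /homogenization scaler_sumr -big_split /=.
by apply: eq_bigr => r _; rewrite coefD coefZ scalerDl scalerA.
Qed.
HB.instance Definition _ M y z := GRing.isLinear.Build K {poly K} {mpoly K[n]} _
  (homogenization M y z) (@homogenization_linear M y z).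

Lemma homogenizationXn M y z r : (r <= M)%N ->
  homogenization M y z 'X^r = y ^+ (M - r) * z ^+ r.
Proof.
move=> rM; rewrite /homogenization (bigD1 (Ordinal (rM : (r < M.+1)%N))) //=.
rewrite coefXn eqxx scale1r big1 ?addr0 // => j; rewrite -val_eqE /= coefXn.
by move/negPf => ->; rewrite scale0r.
Qed.

Lemma homogenizationM M N y z (q r : {poly K}) :
  (size q <= M.+1)%N -> (size r <= N.+1)%N ->
  homogenization (M + N) y z (q * r) =
  homogenization M y z q * homogenization N y z r.
Proof.
move=> sq sr; rewrite (poly_sumXn sq) (poly_sumXn sr) mulr_suml !linear_sum.
rewrite mulr_suml; apply: eq_bigr => i _; rewrite mulr_sumr !linear_sum.
rewrite mulr_sumr; apply: eq_bigr => j _ /=.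
rewrite -scalerAl -scalerAr !linearZ /= -exprD.
have [iM jN] : (i <= M)%N /\ (j <= N)%N by split; rewrite -ltnS.
rewrite !homogenizationXn ?leq_add // -scalerAl -scalerAr; do 2 congr (_ *: _).
have -> : (M + N - (i + j))%N = ((M - i) + (N - j))%N by lia.
by rewrite !exprD; ring.
Qed.

Lemma homogenization_linearX N y z t :
  homogenization N y z ((1 + t *: 'X) ^+ N) = (y + t *: z) ^+ N.
Proof.
elim: N => [|N IH].
  by rewrite expr0 -(expr0 'X) homogenizationXn // !expr0 mulr1.
rewrite -addn1 exprD expr1 homogenizationM ?size_linearX ?size_linear // IH.
have E1 : homogenization 1 y z 1 = y.
  by rewrite -(expr0 'X) homogenizationXn // subn0 expr1 expr0 mulr1.
have EX : homogenization 1 y z 'X = z.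
  by rewrite -(expr1 'X) homogenizationXn // subnn expr1 expr0 mul1r.
by rewrite linearD linearZ /= E1 EX addn1 exprSr.
Qed.

Definition form_on S i f : Prop := forall m, m \in msupp f ->
  mdeg m = i /\ forall k, k \notin S -> m k = 0%N.

Lemma form_on0 S i : form_on S i 0.
Proof. by move=> m; rewrite msupp0. Qed.

Lemma form_onD S i f g : form_on S i f -> form_on S i g -> form_on S i (f + g).
Proof.
by move=> Sf Sg m /msuppD_le; rewrite mem_cat => /orP[/Sf|/Sg].
Qed.

Lemma form_onZ S i c f : form_on S i f -> form_on S i (c *: f).
Proof. by move=> Sf m /msuppZ_le /Sf. Qed.

Lemma form_onB S i f g : form_on S i f -> form_on S i g -> form_on S i (f - g).
Proof. by move=> Sf Sg; rewrite -scaleN1r; apply: form_onD => //; apply: form_onZ. Qed.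

Lemma form_onM S i j f g : form_on S i f -> form_on S j g ->
  form_on S (i + j) (f * g).
Proof.
move=> Sf Sg m /msuppM_le /allpairsP[[m1 m2] /= [/Sf[d1 s1] /Sg[d2 s2] ->]].
split=> [|k kS]; first by rewrite mdegD d1 d2.
by rewrite mnmDE s1 // s2.
Qed.

Lemma form_onX S m : (forall k, k \notin S -> m k = 0%N) ->
  form_on S (mdeg m) 'X_[m].
Proof. by move=> Sm m'; rewrite msuppX inE => /eqP ->. Qed.

Lemma form_onXU S k : k \in S -> form_on S 1 'X_k.
Proof.
move=> kS; rewrite -[X in form_on _ X](mdeg1 k); apply: form_onX => j jS.
by rewrite mnm1E; case: eqP jS => // <-; rewrite kS.
Qed.

Lemma form_onXn S l k : form_on S 1 l -> form_on S k (l ^+ k).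
Proof.
move=> Sl; elim: k => [|k IH]; last by rewrite exprS -add1n; apply: form_onM.
rewrite expr0 -mpolyX0 -[X in form_on _ X](@mdeg0 n); apply: form_onX => j _.
by rewrite mnm0E.
Qed.

Lemma form_on_sub S (T : {set 'I_n}) i f : S \subset T -> form_on S i f -> form_on T i f.
Proof.
move=> /subsetP ST Sf m /Sf[dm Sm]; split=> // k kT; apply: Sm.
by apply: contra kT => /ST.
Qed.

Lemma form_onT i f : form_on [set: 'I_n] i f <-> f \is i.-homog.
Proof.
split=> [Tf|/dhomogP hf m /hf dm].
  by apply/dhomogP => m /Tf[].
by split=> // k; rewrite inE.
Qed.

Lemma form_on_ind S i (P : {mpoly K[n]} -> Prop) : P 0 ->
  (forall f g, P f -> P g -> P (f + g)) -> (forall c f, P f -> P (c *: f)) ->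
  (forall m, mdeg m = i -> (forall k, k \notin S -> m k = 0%N) -> P 'X_[m]) ->
  forall f, form_on S i f -> P f.
Proof.
move=> P0 PD PZ PX f Sf; rewrite (mpolyE f) big_seq.
by elim/big_ind: _ => // m /Sf[dm Sm]; apply/PZ/PX.
Qed.

Lemma form_on_homogenization S M y z q : form_on S 1 y -> form_on S 1 z ->
  form_on S M (homogenization M y z q).
Proof.
move=> Sy Sz; rewrite /homogenization.
elim/big_ind: _ => [|f g|r _]; [exact: form_on0|exact: form_onD|].
have rM : (r <= M)%N by rewrite -ltnS.
have eM : M = (M - r + r)%N by rewrite subnK.
apply: form_onZ; rewrite [X in form_on _ X]eM.
by apply: form_onM; apply: form_onXn.
Qed.

Definition is_ideal (I : {mpoly K[n]} -> Prop) : Prop :=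
  [/\ I 0, forall f g, I f -> I g -> I (f + g) & forall f g, I g -> I (f * g)].

Section Ideal.
Variable I : {mpoly K[n]} -> Prop.
Hypothesis idealI : is_ideal I.

Lemma ideal0 : I 0. Proof. by case: idealI. Qed.
Lemma idealD f g : I f -> I g -> I (f + g). Proof. by case: idealI => _ + _; apply. Qed.
Lemma idealMl f g : I g -> I (f * g). Proof. by case: idealI => _ _; apply. Qed.
Lemma idealMr f g : I f -> I (f * g). Proof. by rewrite mulrC; apply: idealMl. Qed.
Lemma idealZ c f : I f -> I (c *: f).
Proof. by rewrite -mul_mpolyC; apply: idealMl. Qed.
Lemma ideal_sum (J : Type) (s : seq J) (P : pred J) (F : J -> {mpoly K[n]}) :
  (forall j, P j -> I (F j)) -> I (\sum_(j <- s | P j) F j).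
Proof.
move=> IF; elim/big_ind: _ => //; [exact: ideal0|exact: idealD].
Qed.
Lemma ideal_expr_leq f j k : (j <= k)%N -> I (f ^+ j) -> I (f ^+ k).
Proof. by move=> jk If; rewrite -(subnK jk) exprD; apply: idealMl. Qed.

(* Surjectivity half of the strong Lefschetz property, at socle degree d, for
   the image in the quotient by I of the polynomials in the variables of S.
   For a Gorenstein algebra the injectivity half follows by duality. *)
Definition Lefschetz_on S d l : Prop :=
  [/\ form_on S 1 l,
      forall M f, (d < M)%N -> form_on S M f -> I f &
      forall i f, (i.*2 <= d)%N -> form_on S (d - i) f ->
        exists2 g, form_on S i g & I (f - l ^+ (d - i.*2) * g)].

(** Modulo [I], every form is a sum of products [l ^+ k * p] with [p] primitive. For [f] of degree
    [s > 0] in the lower half, [l ^+ (d - 2s + 1) * f] is congruent to [l ^+ (d - 2s + 2) * g] with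
    [g] of degree [s - 1]; then [f - l * g] is primitive and induction handles [g]. *)
Lemma primitive_decomposition S d l (Q : {mpoly K[n]} -> Prop) M :
  Lefschetz_on S d l ->
  (forall f, I f -> Q f) -> (forall f g, Q f -> Q g -> Q (f + g)) ->
  (forall s k p, (s.*2 <= d)%N -> (k + s)%N = M -> form_on S s p ->
     I (l ^+ (d - s.*2).+1 * p) -> Q (l ^+ k * p)) ->
  forall f, form_on S M f -> Q f.
Proof.
move=> [Sl vanish surj] QI QD Qp.
have low s : forall k f, (s.*2 <= d)%N -> (k + s)%N = M -> form_on S s f ->
    Q (l ^+ k * f).
  elim: s => [|s IH] k f sd kM Sf.
    apply: (Qp 0%N) => //; apply: (vanish (d - 0.*2).+1); first by lia.
    by rewrite -[X in form_on _ X _]addn0; apply: form_onM => //; apply: form_onXn.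
  have sd' : (s.*2 <= d)%N by lia.
  have Slf : form_on S (d - s) (l ^+ (d - s.+1.*2).+1 * f).
    rewrite (_ : (d - s)%N = ((d - s.+1.*2).+1 + s.+1)%N); last by lia.
    by apply: form_onM => //; apply: form_onXn.
  have [g Sg Ig] := surj s _ sd' Slf.
  rewrite (_ : l ^+ k * f = l ^+ k.+1 * g + l ^+ k * (f - l * g)); last first.
    by rewrite exprS; ring.
  apply: QD; first by apply: IH => //; lia.
  apply: (Qp s.+1) => //; last first.
    rewrite (_ : _ * _ = l ^+ (d - s.+1.*2).+1 * f - l ^+ (d - s.*2) * g) //.
    rewrite (_ : (d - s.*2)%N = (d - s.+1.*2).+2); last by lia.
    by rewrite !exprS; ring.
  by apply: form_onB => //; rewrite -add1n; apply: form_onM.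
move=> f Sf; have [dM|Md] := ltnP d M; first by apply/QI/(vanish M).
have [hM|hM] := leqP M.*2 d.
  by rewrite -[f]mul1r -(expr0 l); apply: (low M).
(* Above the middle degree, surjectivity first replaces [f] by a power of [l] times a form of degree
   [d - M]. *)
have id : ((d - M).*2 <= d)%N by lia.
have [|g Sg Ig] := surj _ f id; first by rewrite subKn.
rewrite -[f](subrK (l ^+ (d - (d - M).*2) * g)); apply: QD; first exact: QI.
by apply: (low (d - M)%N) => //; lia.
Qed.

End Ideal.
End Forms.

(** * Adjoining a variable *)

Section AddVariable.
Variables (K : fieldType) (n : nat).
Hypothesis charK : [pchar K] =i pred0.
Variable I : {mpoly K[n]} -> Prop.
Hypothesis idealI : is_ideal I.
Implicit Types (f g l p : {mpoly K[n]}) (S : {set 'I_n}).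

Lemma homogenization_ideal M y z (q : {poly K}) p :
  (forall r, (r <= M)%N -> q`_r != 0 -> I (y ^+ (M - r) * z ^+ r * p)) ->
  I (homogenization M y z q * p).
Proof.
move=> Iq; rewrite /homogenization mulr_suml; apply: ideal_sum => // r _.
rewrite -scalerAl; have [->|qr] := eqVneq q`_r 0.
  by rewrite scale0r; apply: ideal0.
apply: idealZ => //; apply: Iq => //.
by rewrite -ltnS ltn_ord.
Qed.

(* A primitive element p of degree s makes K[y, z]/(y^(d-2s+1), z^(e+1)) act
   on p through y |-> l and z |-> 'X_k; this algebra has the strong Lefschetz
   property, and its degrees are centered as those of the whole algebra. *)
Lemma Lefschetz_on_add_variable S d l k e :
  Lefschetz_on I S d l -> k \notin S -> I ('X_k ^+ e.+1) ->
  generically (fun t => Lefschetz_on I (k |: S) (d + e) (l + t *: 'X_k)).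
Proof.
move=> SL kS Xe; have [Sl vanish _] := SL.
(* In degree [d - 2s + e] these are the moments of the monomial [y^(d - 2s) z^e], the dual generator
   of the two-variable algebra acting on a primitive element of degree [s]. *)
pose delta (j : nat) : K := (j == e)%:R.
pose P s (t : K) := forall i (q : {poly K}), (i.*2 <= d - s.*2 + e)%N ->
  (size q <= (d - s.*2 + e - i).+1)%N ->
  exists2 c : {poly K}, (size c <= i.+1)%N &
    forall h : {poly K}, (size h <= i.+1)%N ->
    moment_functional (d - s.*2 + e) delta
      ((q - (1 + t *: 'X) ^+ (d - s.*2 + e - i.*2) * c) * h) = 0.
have gP s : (s < d.+1)%N -> generically (P s).
  by move=> _; apply: generically_binary_Lefschetz.
apply: genericallyW (generically_all gP) => t Pt.
have Sk : S \subset k |: S by apply: subsetUr.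
have Skk : form_on (k |: S) 1 ('X_k : {mpoly K[n]}) by apply: form_onXU; apply: setU11.
have Sl' : form_on (k |: S) 1 l by apply: form_on_sub Sl.
have split_mon (m : 'X_{1..n}) : (forall j, j \notin k |: S -> m j = 0%N) ->
    exists2 m' : 'X_{1..n}, (forall j, j \notin S -> m' j = 0%N) &
      mdeg m = (m k + mdeg m')%N /\
      'X_[m] = 'X_k ^+ m k * 'X_[m'] :> {mpoly K[n]}.
  move=> Sm; have le : (U_(k) *+ m k <= m)%MM.
    apply/mnm_lepP => j; rewrite mulmnE mnm1E.
    by case: eqP => [->|_]; rewrite ?mul1n ?mul0n.
  exists (m - U_(k) *+ m k)%MM => [j jS|].
    rewrite mnmBE mulmnE mnm1E; have [<-|kj] := eqVneq k j.
      by rewrite mul1n subnn.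
    by rewrite Sm // !inE negb_or eq_sym kj.
  rewrite mpolyXn -mpolyXD addmC submK //; split=> //.
  by rewrite -{1}(submK le) mdegD mdegMn mdeg1 mul1n addnC.
have linl : form_on (k |: S) 1 (l + t *: 'X_k).
  by apply: form_onD => //; apply: form_onZ.
split=> // [M f dM|i f ide].
  apply: form_on_ind => [|||m dm Sm]; [exact: ideal0|exact: idealD| |].
    by move=> *; exact: idealZ.
  have [m' Sm' [dm' ->]] := split_mon m Sm.
  have [me|em] := leqP (m k) e; last first.
    by apply: idealMr => //; apply: ideal_expr_leq Xe.
  by apply: idealMl => //; apply: (vanish (mdeg m')); [lia|apply: form_onX].
elim/form_on_ind => {f} [|f g|c f|m dm Sm].
- by exists 0; rewrite ?mulr0 ?subr0; [exact: form_on0|exact: ideal0].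
- move=> [f' Sf' If'] [g' Sg' Ig']; exists (f' + g'); first exact: form_onD.
  by rewrite mulrDr opprD addrACA; apply: idealD.
- move=> [f' Sf' If']; exists (c *: f'); first exact: form_onZ.
  by rewrite -scalerAr -scalerBr; apply: idealZ.
have [m' Sm' [dm' ->]] := split_mon m Sm.
have [me|em] := leqP (m k) e; last first.
  exists 0; rewrite ?mulr0 ?subr0; first exact: form_on0.
  by apply: idealMr => //; apply: ideal_expr_leq Xe.
rewrite {}dm in dm'; move: {m Sm} (m k) dm' me => j dm' je.
have Sm : form_on S (mdeg m') ('X_[m'] : {mpoly K[n]}) by apply: form_onX.
move: 'X_[m'] Sm; refine (primitive_decomposition SL (Q := fun h =>
  exists2 g, form_on (k |: S) i g &
    I ('X_k ^+ j * h - (l + t *: 'X_k) ^+ (d + e - i.*2) * g)) _ _ _)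
  => [f If|f g|s r p sd rs Sp Ip].
- by exists 0; rewrite ?mulr0 ?subr0; [exact: form_on0|exact: idealMl].
- move=> [f' Sf' If'] [g' Sg' Ig']; exists (f' + g'); first exact: form_onD.
  by rewrite !mulrDr opprD addrACA; apply: idealD.
(* Here [r > d - 2s], so [l ^+ r * p] is already in [I]. *)
have [si|si] := ltnP i s.
  exists 0; rewrite ?mulr0 ?subr0; first exact: form_on0.
  have rd : ((d - s.*2).+1 <= r)%N by lia.
  by rewrite -(subnK rd) exprD -mulrA; do 2 apply: idealMl => //.
have [|||c sc cP] := Pt s _ (i - s)%N 'X^j; [by lia|by lia|by rewrite size_polyXn; lia|].
have eN : (d - s.*2 + e - (i - s).*2)%N = (d + e - i.*2)%N by lia.
have rjN : (r + j)%N = (d + e - i.*2 + (i - s))%N by lia.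
rewrite eN in cP.
exists (homogenization (i - s) l 'X_k c * p).
  have ei : i = (i - s + s)%N by rewrite subnK.
  rewrite [X in form_on _ X _]ei.
  by apply: form_onM; [exact: form_on_homogenization|exact: form_on_sub Sp].
have -> : 'X_k ^+ j * (l ^+ r * p) -
    (l + t *: 'X_k) ^+ (d + e - i.*2) * (homogenization (i - s) l 'X_k c * p) =
    homogenization (r + j) l 'X_k ('X^j - (1 + t *: 'X) ^+ (d + e - i.*2) * c) * p.
  rewrite linearB /= homogenizationXn ?leq_addl // addnK rjN.
  rewrite homogenizationM // ?size_linearX // homogenization_linearX; ring.
(* The term in ['X_k ^+ b] lies in [I] if [b > e], or if [e - b > i - s] because the power of [l]
   then kills [p]. Otherwise its coefficient is read off by the functional with test polynomial
   ['X^(e - b)], and is zero. *)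
apply: homogenization_ideal => b ble qb.
have [be|eb] := leqP b e; last first.
  by apply: idealMr => //; apply: idealMl => //; apply: ideal_expr_leq Xe.
have [bi|ib] := leqP (e - b) (i - s); last first.
  rewrite mulrAC; apply: idealMr => //.
  have rd : ((d - s.*2).+1 <= r + j - b)%N by lia.
  by rewrite -(subnK rd) exprD -mulrA; apply: idealMl.
case/eqP: qb.
have := cP 'X^(e - b); rewrite size_polyXn ltnS => /(_ bi).
rewrite /moment_functional (bigD1 (inord e)) //= inordK ?ltnS ?leq_addl //.
rewrite /delta eqxx mul1r big1 ?addr0 => [|b' /negPf ne].
  by rewrite coefMXn ltnNge leq_subr /= subKn.
by rewrite -val_eqE /= inordK ?ltnS ?leq_addl // in ne; rewrite ne mul0r.
Qed.

Lemma Lefschetz_on_add_variables S d l (e : 'I_n -> nat) :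
  Lefschetz_on I S d l -> (forall k, k \notin S -> I ('X_k ^+ (e k).+1)) ->
  exists l', Lefschetz_on I setT (d + \sum_(k | k \notin S) e k) l'.
Proof.
have [N] := ubnP #|~: S|; elim: N => // N IH in S d l *.
move=> leN SL Xe; have [ST|] := eqVneq S setT.
  by exists l; rewrite ST big_pred0 ?addn0 -?ST // => k; rewrite ST inE.
rewrite eqEsubset subsetT /= => /subsetPn[k _ kS].
have [t tL] := generically_ex charK (Lefschetz_on_add_variable SL kS (Xe k kS)).
have [||l' l'L] := IH _ _ _ _ tL.
- rewrite ltnS in leN; apply: leq_trans leN; apply: proper_card.
  rewrite properE setCS subsetUr /=; apply/subsetPn; exists k; first by rewrite inE.
  by rewrite !inE eqxx.
- by move=> j; rewrite !inE negb_or => /andP[_]; apply: Xe.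
exists l'; rewrite (bigD1 k) //= addnA; congr (Lefschetz_on _ _ (_ + _) _): l'L.
by apply: eq_bigl => j; rewrite !inE negb_or andbC.
Qed.
End AddVariable.

(** * The annihilator of a binomial *)

Section BinomialAnnihilator.
Variables (K : fieldType) (n : nat).
Implicit Types (f g h l : {mpoly K[n]}) (a b m w : 'X_{1..n}).

(** The coefficient of [X^[w]] in the contraction of [X^[a]] by [f]. *)
Definition shifted_coeff f a w : K := if (w <= a)%MM then f@_(a - w) else 0.

Lemma shifted_coeffD f g a w :
  shifted_coeff (f + g) a w = shifted_coeff f a w + shifted_coeff g a w.
Proof. by rewrite /shifted_coeff; case: ifP => _; rewrite ?mcoeffD ?addr0. Qed.

Lemma shifted_coeffZ c f a w :
  shifted_coeff (c *: f) a w = c * shifted_coeff f a w.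
Proof. by rewrite /shifted_coeff; case: ifP => _; rewrite ?mcoeffZ ?mulr0. Qed.

Lemma mcoeffXM m f w :
  ('X_[m] * f)@_w = if (m <= w)%MM then f@_(w - m) else 0.
Proof.
case: ifP => [le|nle].
  by rewrite -{1}(submK le) addmC mulrC mcoeffMX.
apply/eqP; rewrite mcoeff_eq0; apply: contraFN nle => /msuppM_le.
case/allpairsP => [[m1 m2] /= [+ _ ->]]; rewrite msuppX inE => /eqP ->.
exact: lem_addr.
Qed.

Lemma shifted_coeffXM m f a w :
  shifted_coeff ('X_[m] * f) a w = shifted_coeff f a (m + w).
Proof.
rewrite /shifted_coeff mcoeffXM submDA (addmC m w).
have -> : (w + m <= a)%MM = (w <= a)%MM && (m <= a - w)%MM.
  apply/mnm_lepP/andP => [le|[/mnm_lepP le1 /mnm_lepP le2] i].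
    split; apply/mnm_lepP => i; have := le i; rewrite ?mnmDE ?mnmBE; lia.
  by have := le1 i; have := le2 i; rewrite mnmDE mnmBE; lia.
by case: (w <= a)%MM.
Qed.

Definition binomial_ann (c1 : K) a (c2 : K) b f : Prop :=
  forall w, c1 * shifted_coeff f a w + c2 * shifted_coeff f b w = 0.

Lemma binomial_annC c1 a c2 b f : binomial_ann c1 a c2 b f ->
  binomial_ann c2 b c1 a f.
Proof. by move=> If w; rewrite addrC. Qed.

Lemma mcoeff_contract f F w :
  (contract f F)@_w = \sum_(m <- msupp f) f@_m * F@_(m + w).
Proof.
rewrite /contract raddf_sum; apply: eq_bigr => m _; rewrite raddf_sum /=.
under eq_bigr do rewrite mcoeffZ -mulrA.
rewrite -mulr_sumr; congr (_ * _).
have E a : (if (m <= a)%MM then 'X_[a - m] else 0 : {mpoly K[n]})@_w =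
    (a == m + w)%MM%:R.
  case: ifP => le.
    by rewrite mcoeffX -(eqm_add2r m) submK // addmC.
  by rewrite mcoeff0; case: eqP le => // ->; rewrite lem_addr.
under eq_bigr do rewrite E.
have [mw|mw] := boolP ((m + w)%MM \in msupp F).
  rewrite (bigD1_seq (m + w)%MM) ?msupp_uniq //= eqxx mulr1 big1 ?addr0 // => a.
  by move/negPf => ->; rewrite mulr0.
rewrite (memN_msupp_eq0 mw) big_seq big1 // => a aF.
by case: eqP aF mw => [-> -> //|_ _ _]; rewrite mulr0.
Qed.

Lemma Ann_binomial F a b f : a != b -> msupp F =i [:: a; b] ->
  Ann F f <-> binomial_ann F@_a a F@_b b f.
Proof.
move=> ab sF.
have E w : (contract f F)@_w =
    F@_a * shifted_coeff f a w + F@_b * shifted_coeff f b w.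
  have sum1 c : \sum_(m <- msupp f) f@_m * (c == m + w)%MM%:R = shifted_coeff f c w.
    rewrite /shifted_coeff; case: ifP => [le|nle].
      have Ec m : (c == m + w)%MM = (m == c - w)%MM.
        by rewrite -{1}(submK le) eqm_add2r eq_sym.
      under eq_bigr do rewrite Ec.
      have [cw|cw] := boolP ((c - w)%MM \in msupp f).
        rewrite (bigD1_seq (c - w)%MM) ?msupp_uniq //= eqxx mulr1.
        by rewrite big1 ?addr0 // => m /negPf ->; rewrite mulr0.
      rewrite (memN_msupp_eq0 cw) big_seq big1 // => m mf.
      by case: eqP mf cw => [-> -> //|_ _ _]; rewrite mulr0.
    rewrite big1 // => m _; case: eqP nle => [->|_]; last by rewrite mulr0.
    by rewrite lem_addl.
  rewrite mcoeff_contract -!sum1 !mulr_sumr -big_split /=; apply: eq_bigr => m _.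
  have -> : F@_(m + w) = F@_a * (a == m + w)%MM%:R + F@_b * (b == m + w)%MM%:R.
    have [<-|na] := eqVneq a (m + w)%MM.
      by rewrite eq_sym (negPf ab) mulr1 mulr0 addr0.
    have [<-|nb] := eqVneq b (m + w)%MM; first by rewrite mulr1 mulr0 add0r.
    rewrite !mulr0 addr0; apply: memN_msupp_eq0.
    by rewrite sF !inE negb_or ![(m + w == _)%MM]eq_sym na.
  by ring.
rewrite /Ann /binomial_ann; split=> [E0 w|E0]; first by rewrite -E E0 mcoeff0.
by apply/mpolyP => w; rewrite E E0 mcoeff0.
Qed.

Variables (a b : 'X_{1..n}) (c1 c2 : K) (d : nat).
Hypotheses (da : mdeg a = d) (db : mdeg b = d).
Local Notation I := (binomial_ann c1 a c2 b).

Lemma binomial_ann_ideal : is_ideal I.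
Proof.
have I0 : I 0.
  by move=> w; rewrite /shifted_coeff !mcoeff0 !if_same !mulr0 addr0.
have ID f g : I f -> I g -> I (f + g).
  move=> If Ig w; rewrite !shifted_coeffD !mulrDr addrACA.
  by rewrite If Ig addr0.
split=> // f g Ig; rewrite (mpolyE f) mulr_suml.
elim/big_ind: _ => // m _ w.
rewrite -scalerAl !shifted_coeffZ !shifted_coeffXM.
rewrite !(mulrCA _ f@_m) -mulrDr.
by rewrite Ig mulr0.
Qed.

Lemma mdeg_sub_le w m : (w <= m)%MM -> mdeg (m - w) = (mdeg m - mdeg w)%N.
Proof. by move=> le; rewrite -{2}(submK le) mdegD addnK. Qed.

Lemma shifted_coeff_homog0 i f m w : f \is i.-homog ->
  (i + mdeg w)%N != mdeg m -> shifted_coeff f m w = 0.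
Proof.
move=> hf ne; rewrite /shifted_coeff; case: ifP => // le.
apply: dhomog_nemf_coeff hf _; apply: contra ne => /eqP <-.
by rewrite -{2}(submK le) mdegD.
Qed.

Lemma binomial_ann_vanish M f : (d < M)%N -> f \is M.-homog -> I f.
Proof.
move=> dM hf w; rewrite !(shifted_coeff_homog0 hf) ?mulr0 ?addr0 // ?da ?db.
  by apply/eqP; lia.
by apply/eqP; lia.
Qed.

(** The coefficient of [X^[w]] in the contraction of the binomial by [f] is the constant coefficient
    of its contraction by ['X_[w] * f], so products of socle degree detect membership. *)
Lemma binomial_ann_duality i f : f \is i.-homog ->
  (forall m, (mdeg m + i)%N = d -> I ('X_[m] * f)) -> I f.
Proof.
move=> hf If w; have [wd|wd] := eqVneq (i + mdeg w)%N d.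
  by have := If w _ 0%MM; rewrite !shifted_coeffXM !addm0; apply; rewrite addnC.
by rewrite !(shifted_coeff_homog0 hf) ?mulr0 ?addr0 ?da ?db.
Qed.

(** If [d <= 2i + k], either degree [i + k] is beyond the socle or the surjective power of [l] into
    it factors through [l ^+ k]. Otherwise every monomial of degree [d - i] is congruent to a
    multiple of [l ^+ k], so duality gives injectivity. *)
Lemma strong_Lefschetz_of_Lefschetz_on l : Lefschetz_on I setT d l ->
  strong_Lefschetz_quot I.
Proof.
have idI := binomial_ann_ideal.
move=> [Tl _ surj]; have hl : l \is 1.-homog by apply/form_onT.
have hlX k : l ^+ k \is k.-homog by rewrite -{2}[k]mul1n; apply: dhomogMn.
exists l; split=> // i k k_gt0; have [dik|dik] := leqP d (i.*2 + k).
  right=> h hh; have [ikd|ikd] := leqP (i + k) d; last first.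
    exists 0; split; first exact: dhomog0.
    by rewrite mulr0 subr0; apply: binomial_ann_vanish ikd hh.
  have [||g Tg Ig] := surj (d - (i + k))%N h; first by lia.
    by apply/form_onT; rewrite subKn.
  exists (l ^+ (i - (d - (i + k))) * g); split.
    have ki : (d - (i + k) <= i)%N by lia.
    by rewrite -[X in _ \is X.-homog](subnK ki) dhomogM //; apply/form_onT.
  rewrite mulrA -exprD.
  by have -> : (k + (i - (d - (i + k))) = d - (d - (i + k)).*2)%N by lia.
left=> f hf If; apply: (binomial_ann_duality hf) => m dm.
have [||g _ Ig] := surj i 'X_[m]; first by lia.
  by apply/form_onT; rewrite dhomogX /= -dm addnK.
rewrite -['X_[m]](subrK (l ^+ (d - i.*2) * g)) mulrDl; apply: (idealD idI).
  exact: (idealMr idI).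
have -> : (d - i.*2)%N = ((d - i.*2 - k) + k)%N by lia.
rewrite exprD (_ : _ * f = l ^+ (d - i.*2 - k) * g * (l ^+ k * f)); last by ring.
exact: (idealMl idI).
Qed.

Lemma binomial_annX m : ~~ (m <= a)%MM -> ~~ (m <= b)%MM -> I 'X_[m].
Proof.
move=> ma mb w.
have E c : ~~ (m <= c)%MM -> shifted_coeff 'X_[m] c w = 0.
  move=> mc; rewrite /shifted_coeff; case: ifP => // le.
  by rewrite mcoeffX; case: eqP mc => // ->; rewrite lem_subr.
by rewrite !E // !mulr0 addr0.
Qed.

(** The coefficient of [X^[a - m]] in the contraction is [c1 * f@_m] alone, because [a - m] is not
    below [b]. *)
Lemma binomial_ann_coeff0 f m : c1 != 0 -> I f -> (m <= a)%MM -> ~~ (a <= m + b)%MM ->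
  f@_m = 0.
Proof.
clear da db; move=> c1_neq0 If ma mb.
have := If (a - m)%MM; rewrite /shifted_coeff lem_subr.
case: ifP => [/mnm_lepP le|_].
  case/mnm_lepP: mb => i; have := le i.
  by rewrite mnmBE mnmDE; lia.
rewrite mulr0 addr0 submBA // addmC addmK => /eqP.
by rewrite mulf_eq0 (negPf c1_neq0) => /eqP.
Qed.

Lemma mcoeff_pihomog M f m : (pihomog mdeg M f)@_m = if mdeg m == M then f@_m else 0.
Proof.
case: eqP => [dm|dm]; last first.
  by apply: (dhomog_nemf_coeff (pihomogP _ _ _)); apply/eqP.
rewrite {2}(mpolyE f) pihomogE !raddf_sum /= big_mkcond /=.
apply: eq_bigr => m' _; rewrite !mcoeffZ !mcoeffX.
by have [->|_] := eqVneq m' m; rewrite ?dm ?eqxx // mulr0 if_same.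
Qed.

Lemma binomial_ann_pihomog M f : I f -> I (pihomog mdeg M f).
Proof.
move=> If w.
have E m : mdeg m = d -> shifted_coeff (pihomog mdeg M f) m w =
    if (M + mdeg w == d)%N then shifted_coeff f m w else 0.
  move=> dm; rewrite /shifted_coeff; case: ifP => le; last by rewrite if_same.
  by rewrite mcoeff_pihomog -dm -[X in _ == mdeg X](submK le) mdegD eqn_add2r eq_sym.
by rewrite !E //; case: ifP => _; rewrite ?If // !mulr0 addr0.
Qed.

End BinomialAnnihilator.

(** * Degeneration to a monomial complete intersection *)

Lemma form_on_coeff0 (K : fieldType) n (S : {set 'I_n}) i (f : {mpoly K[n]}) m :
  form_on S i f -> mdeg m != i -> f@_m = 0.
Proof.
move=> Sf dm; apply: memN_msupp_eq0; apply: contra dm => /Sf[-> _].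
exact: eqxx.
Qed.

Lemma mnmU_le n (k : 'I_n) j (m : 'X_{1..n}) : (j <= m k)%N ->
  (U_(k) *+ j <= m)%MM.
Proof.
move=> le; apply/mnm_lepP => i; rewrite mulmnE mnm1E.
by case: eqP => [<-|_]; rewrite ?mul1n ?mul0n.
Qed.

Section Degeneration.
Variables (K : fieldType) (n : nat).
Hypothesis charK : [pchar K] =i pred0.
Implicit Types (f g h l : {mpoly K[n]}) (m : 'X_{1..n}).

Lemma generically_unitmx N (B : 'M[{poly K}]_N) :
  map_mx (horner_eval 0) B = 1%:M ->
  generically (fun t => map_mx (horner_eval t) B \in unitmx).
Proof.
move=> B1; exists (\det B) => [|t Bt]; last by rewrite unitmxE unitfE det_map_mx.
apply/eqP => B0; have := oner_neq0 K; rewrite -(det1 K N) -B1 det_map_mx B0.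
by rewrite /= /horner_eval horner0 eqxx.
Qed.

(** The ideal generated by the powers ['X_k ^+ (e k).+1], described by the monomials outside it. *)
Definition monomial_ideal (e : 'I_n -> nat) g : Prop :=
  forall m, (forall k, m k <= e k)%N -> g@_m = 0.

Lemma monomial_ideal_ideal e : is_ideal (monomial_ideal e).
Proof.
split=> [m _|f g Jf Jg m me|f g Jg m me]; first exact: mcoeff0.
  by rewrite mcoeffD Jf // Jg // addr0.
rewrite mcoeffM big1 // => -[m1 m2] /= /eqP Em; rewrite Jg ?mulr0 // => k.
apply: leq_trans (me k); have := congr1 (fun m' : 'X_{1..n} => m' k) Em.
by rewrite /= mnmDE => ->; apply: leq_addl.
Qed.

Lemma monomial_ideal_Lefschetz e :
  exists l, Lefschetz_on (monomial_ideal e) setT (\sum_k e k) l.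
Proof.
have idJ := monomial_ideal_ideal e.
(* Induction starts from the constants, with socle degree 0; all variables are then adjoined. *)
have L0 : Lefschetz_on (monomial_ideal e) set0 0 0.
  split=> [|M f M0 f0|i f]; first exact: form_on0.
    have -> : f = 0; last exact: ideal0.
    apply: msuppnil0; case E: (msupp f) => [//|m s].
    have [|dm m0] := f0 m; first by rewrite E inE eqxx.
    have : mdeg m = 0%N by rewrite mdegE big1 // => k _; rewrite m0 // inE.
    by lia.
  rewrite leqn0 double_eq0 => /eqP -> f0; exists f => //.
  by rewrite expr0 mul1r subrr; apply: ideal0.
have [|l lL] := Lefschetz_on_add_variables charK idJ (e := e) L0.
  move=> k _ m me; rewrite mpolyXn mcoeffX; case: eqP => // Em.
  by have := me k; rewrite -Em mulmnE mnm1E eqxx mul1n ltnn.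
exists l; congr (Lefschetz_on _ _ _ _): lL.
by apply: eq_bigl => k; rewrite inE.
Qed.

Variable k0 : 'I_n.

Definition rescale (t : K) f : {mpoly K[n]} :=
  f \mPo [tuple if k == k0 then 'X_k else t *: 'X_k | k < n].

HB.instance Definition _ t := GRing.LRMorphism.copy (rescale t)
  (comp_mpoly [tuple if k == k0 then 'X_k else t *: 'X_k | k < n]).

Lemma rescaleX t m : rescale t 'X_[m] = t ^+ (mdeg m - m k0) *: 'X_[m].
Proof.
rewrite /rescale comp_mpolyX (bigD1 k0) //= tnth_mktuple eqxx.
have -> : (mdeg m - m k0)%N = (\sum_(k | k != k0) m k)%N.
  by rewrite mdegE (bigD1 k0) //= addKn.
rewrite [in RHS](mpolyXE_id K m) [in RHS](bigD1 k0 (F := fun k => 'X_k ^+ m k)) //=.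
rewrite scalerAr; congr (_ * _).
rewrite -prodrXr -scaler_prod; apply: eq_bigr => k /negPf nk.
by rewrite tnth_mktuple nk exprZn.
Qed.

Lemma rescaleK t f : t != 0 -> rescale t^-1 (rescale t f) = f.
Proof.
move=> t0; rewrite {1}(mpolyE f) [RHS]mpolyE.
rewrite (linear_sum (rescale t)) (linear_sum (rescale t^-1)) /=.
apply: eq_bigr => m _.
rewrite !linearZ /= rescaleX linearZ /= rescaleX !scalerA -mulrA -exprMn mulfV //.
by rewrite expr1n mulr1.
Qed.

Lemma rescale_form t i f : form_on setT i f -> form_on setT i (rescale t f).
Proof.
elim/form_on_ind => {f} [|f g Sf Sg|c f Sf|m dm _].
- by rewrite raddf0; apply: form_on0.
- by rewrite raddfD; apply: form_onD.
- by rewrite linearZ; apply: form_onZ.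
by rewrite rescaleX; apply: form_onZ; rewrite -dm; apply: form_onX => k; rewrite inE.
Qed.

Variables (I : {mpoly K[n]} -> Prop) (e : 'I_n -> nat) (f : {mpoly K[n]}).
Hypothesis idealI : is_ideal I.
Hypothesis Xe : forall k, k != k0 -> I ('X_k ^+ (e k).+1).
Hypothesis homf : f \is (e k0).+1.-homog.
Hypothesis f_k0 : f@_(U_(k0) *+ (e k0).+1) = 1.
Hypothesis If : I f.
Local Notation E := (e k0).+1.
Local Notation d := (\sum_k e k)%N.

(** ['X_k0 ^+ E + tail t] is [rescale t f]. Every term of [tail t] carries a positive power of [t],
    so [tail 0] is zero. *)
Definition tail t : {mpoly K[n]} :=
  \sum_(m <- msupp f | (m k0 < E)%N) (f@_m * t ^+ (E - m k0)) *: 'X_[m].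

Lemma rescale_tail t : t != 0 -> rescale t^-1 ('X_k0 ^+ E + tail t) = f.
Proof.
move=> t0; rewrite (linearD (rescale t^-1)) /= mpolyXn rescaleX.
rewrite mdegMn mdeg1 mulmnE mnm1E eqxx mul1n subnn expr0 scale1r.
rewrite [RHS]mpolyE (bigID (fun m : 'X_{1..n} => (m k0 < E)%N)) /= addrC.
rewrite /tail (linear_sum (rescale t^-1)) /=; congr (_ + _); last first.
  rewrite big_seq_cond [RHS]big_seq_cond; apply: eq_bigr => m /andP[mf _].
  rewrite linearZ /= rescaleX scalerA (dhomog_mf homf mf).
  by rewrite -mulrA -exprMn mulfV // expr1n mulr1.
have Em m : m \in msupp f -> ~~ (m k0 < E)%N = (m == U_(k0) *+ E)%MM.
  move=> mf; rewrite -leqNgt; apply/idP/eqP => [le|->]; last first.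
    by rewrite mulmnE mnm1E eqxx mul1n.
  have := dhomog_mf homf mf; rewrite /= mdegE (bigD1 k0) //=.
  set s := (\sum_(j | _) m j)%N => dm.
  apply/mnmP => k; rewrite mulmnE mnm1E; have [<-|nk] := eqVneq k0 k; first by lia.
  have : (m k <= s)%N by rewrite /s (bigD1 k) 1?eq_sym //= leq_addr.
  by rewrite mul0n; lia.
rewrite big_mkcond (bigD1_seq (U_(k0) *+ E)%MM) ?msupp_uniq //=; last first.
  by rewrite mcoeff_msupp f_k0 oner_neq0.
rewrite mulmnE mnm1E eqxx mul1n ltnn /= f_k0 scale1r.
rewrite big_seq_cond big1 ?addr0 // => m /andP[mf /negPf ne].
by rewrite Em // ne.
Qed.

Lemma form_on_tail t : form_on setT E (tail t).
Proof.
rewrite /tail big_seq_cond.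
elim/big_ind: _ => [|? ?|m /andP[mf _]]; [exact: form_on0|exact: form_onD|].
apply: form_onZ; rewrite -(dhomog_mf homf mf) /=.
by apply: form_onX => k; rewrite inE.
Qed.

(* As t tends to 0, the ideal obtained by multiplying the variables other than
   'X_k0 by t^-1 degenerates to the monomial complete intersection: the
   equation 'X_k0 ^+ E + tail t tends to 'X_k0 ^+ E. Surjectivity of the
   multiplication maps is an open condition on t. *)
Lemma degeneration_at l i : Lefschetz_on (monomial_ideal e) setT d l ->
  (i.*2 <= d)%N ->
  generically (fun t => forall h, form_on setT (d - i) h ->
    exists2 g, form_on setT i g & I (rescale t^-1 (h - l ^+ (d - i.*2) * g))).
Proof.
move=> [Tl _ surj] id; pose M := (d - i)%N.
pose T : finType := {x : 'X_{1..n < M.+1} | mdeg x == M}.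
pose mon (x : T) : 'X_{1..n} := sval x.
have mon_inj : injective mon by move=> x y /val_inj/val_inj.
pose X (x : T) : {mpoly K[n]} := 'X_[mon x].
have TX x : form_on setT M (X x).
  by rewrite -[X in form_on _ X _](eqP (valP x)); apply: form_onX => k; rewrite inE.
have [g gP] : exists g : T -> {mpoly K[n]}, forall x, form_on setT i (g x) /\
    monomial_ideal e (X x - l ^+ (d - i.*2) * g x).
  have ex x : exists g, form_on setT i g /\
      monomial_ideal e (X x - l ^+ (d - i.*2) * g).
    by have [g ? ?] := surj i (X x) id (TX x); exists g.
  exact: (fin_all_exists ex).
pose r x := X x - l ^+ (d - i.*2) * g x.
have rM x : form_on setT M (r x).
  apply: form_onB => //; rewrite (_ : M = (d - i.*2 + i)%N); last by rewrite /M; lia.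
  by apply: form_onM; [exact: form_onXn|case: (gP x)].
(* [h x] is the quotient by ['X_k0 ^+ E] of the divisible part of the remainder [r x]. After adding
   [h x * tail t] to [X x], the difference with [l ^+ (d - i.*2) * g x] lies in the rescaled
   ideal. *)
pose h x := \sum_(m <- msupp (r x) | (E <= m k0)%N) (r x)@_m *: 'X_[m - U_(k0) *+ E].
(* The coordinates of the corrected forms on the monomials of degree [M]. At [t = 0] this is the
   identity, so generically these forms are a basis in that degree. *)
pose B : 'M[{poly K}]_#|T| := \matrix_(x, y)
  ((x == y)%:R%:P + \sum_(m <- msupp f | (m k0 < E)%N)
     (f@_m * (h (enum_val x) * 'X_[m])@_(mon (enum_val y)))%:P * 'X^(E - m k0)).
have BE t x y : map_mx (horner_eval t) B x y =
    (X (enum_val x) + h (enum_val x) * tail t)@_(mon (enum_val y)).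
  rewrite !mxE /horner_eval hornerD hornerC horner_sum mcoeffD; congr (_ + _).
    rewrite mcoeffX; congr (_ %:R); congr nat_of_bool.
    by rewrite (inj_eq mon_inj) (inj_eq enum_val_inj).
  rewrite /tail mulr_sumr raddf_sum /=; apply: eq_bigr => m _.
  by rewrite hornerCM hornerXn -scalerAr mcoeffZ mulrAC.
have B0 : map_mx (horner_eval 0) B = 1%:M.
  apply/matrixP => x y; rewrite BE mxE.
  have -> : tail 0 = 0.
    rewrite /tail big1 // => m lt; rewrite expr0n subn_eq0 leqNgt lt /=.
    by rewrite mulr0 scale0r.
  rewrite mulr0 addr0 mcoeffX; congr (_ %:R); congr nat_of_bool.
  by rewrite (inj_eq mon_inj) (inj_eq enum_val_inj).
have := generically_and (generically_neq0 K) (generically_unitmx B0).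
apply: genericallyW => t [t0 unitB] p Tp.
pose c : 'rV[K]_#|T| := \row_y p@_(mon (enum_val y)).
pose lam := c *m invmx (map_mx (horner_eval t) B).
have lamB : lam *m map_mx (horner_eval t) B = c by rewrite mulmxKV.
exists (\sum_x lam 0 x *: g (enum_val x)).
  elim/big_ind: _ => [|? ?|x _]; [exact: form_on0|exact: form_onD|].
  by apply: form_onZ; case: (gP (enum_val x)).
pose v (x : 'I_#|T|) := X (enum_val x) + h (enum_val x) * tail t.
have vM x : form_on setT M (v x).
  apply: form_onD => //; rewrite /h mulr_suml big_seq_cond.
  elim/big_ind: _ => [|? ?|m /andP[mr Em]]; [exact: form_on0|exact: form_onD|].
  have le : (U_(k0) *+ E <= m)%MM by apply: mnmU_le.
  have [dm _] := rM _ _ mr.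
  have -> : M = (mdeg (m - U_(k0) *+ E) + E)%N.
    by rewrite -dm -{1}(submK le) mdegD mdegMn mdeg1 mul1n.
  apply: form_onM; last by apply: form_on_tail.
  by apply: form_onZ; apply: form_onX => k; rewrite inE.
have -> : p = \sum_x lam 0 x *: v x.
  apply/mpolyP => m; rewrite raddf_sum /=.
  have [dm|dm] := eqVneq (mdeg m) M; last first.
    rewrite (form_on_coeff0 Tp dm) big1 // => x _.
    by rewrite mcoeffZ (form_on_coeff0 (vM x) dm) mulr0.
  have ltm : (mdeg m < M.+1)%N by rewrite dm.
  pose z : T := exist _ (BMultinom ltm) (introT eqP dm).
  have := congr1 (fun u : 'rV_#|T| => u 0 (enum_rank z)) lamB.
  rewrite [in RHS]mxE enum_rankK => <-; rewrite mxE; apply: eq_bigr => x _.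
  by rewrite BE enum_rankK mcoeffZ.
have -> : \sum_x lam 0 x *: v x - l ^+ (d - i.*2) * (\sum_x lam 0 x *: g (enum_val x)) =
   \sum_x lam 0 x *: (r (enum_val x) - 'X_k0 ^+ E * h (enum_val x) +
     h (enum_val x) * ('X_k0 ^+ E + tail t)).
  rewrite mulr_sumr -sumrB; apply: eq_bigr => x _.
  rewrite -scalerAr -scalerBr /v /r; congr (_ *: _); ring.
rewrite (linear_sum (rescale t^-1)); apply: ideal_sum => // x _.
rewrite linearZ /=; apply: idealZ => //; rewrite (linearD (rescale t^-1)).
apply: idealD => //; last first.
  by rewrite rmorphM /= rescale_tail //; apply: idealMl.
move: (enum_val x) => {}x.
have -> : r x - 'X_k0 ^+ E * h x =
    \sum_(m <- msupp (r x) | (m k0 < E)%N) (r x)@_m *: 'X_[m].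
  rewrite {1}(mpolyE (r x)) (bigID (fun m : 'X_{1..n} => (m k0 < E)%N)) /=.
  rewrite -addrA [X in _ + X](_ : _ = 0) ?addr0 //; apply/eqP; rewrite subr_eq0.
  apply/eqP; rewrite /h mulr_sumr; apply: eq_big => [m|m]; first by rewrite -leqNgt.
  rewrite -leqNgt => Em; rewrite -scalerAr mpolyXn -mpolyXD addmC submK //.
  exact: mnmU_le.
rewrite (linear_sum (rescale t^-1)) big_seq_cond; apply: ideal_sum => // m.
move=> /andP[mr mk0].
rewrite linearZ /= rescaleX; do 2 apply: idealZ => //.
(* [r x] lies in the monomial ideal and the exponent of ['X_k0] is small here, so some other
   exponent is too large. *)
have [k nk mk] : exists2 k, k != k0 & (e k < m k)%N.
  have [_ Jr] := gP x; have [/forallP le|] := boolP [forall k, m k <= e k]%N.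
    by move: mr; rewrite mcoeff_msupp /r Jr ?eqxx.
  rewrite negb_forall => /existsP[k]; rewrite -ltnNge => ek; exists k => //.
  by apply: contraTneq ek => ->; rewrite -leqNgt -ltnS.
rewrite -[m](submK (mnmU_le mk)).
by rewrite mpolyXD -mpolyXn; apply: idealMl => //; apply: Xe.
Qed.

Lemma Lefschetz_on_degeneration :
  (forall M h, (d < M)%N -> form_on setT M h -> I h) ->
  exists l, Lefschetz_on I setT d l.
Proof.
move=> vanish; have [l lL] := monomial_ideal_Lefschetz e.
pose P i t := (i.*2 <= d)%N -> forall h, form_on setT (d - i) h ->
  exists2 g, form_on setT i g & I (rescale t^-1 (h - l ^+ (d - i.*2) * g)).
have gP i : (i < d.+1)%N -> generically (P i).
  move=> _; case: (leqP i.*2 d) => id.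
    by apply: genericallyW (degeneration_at lL id) => t Pt _.
  by apply: generically_true => t; rewrite /P leqNgt id.
have [t [t0 Pt]] := generically_ex charK
  (generically_and (generically_neq0 K) (generically_all gP)).
have [Tl _ _] := lL; exists (rescale t^-1 l).
split=> // [|i h id Th]; first exact: rescale_form.
have [||g Tg Ig] := Pt i _ id (rescale t h); [by lia|exact: rescale_form|].
exists (rescale t^-1 g); first exact: rescale_form.
by move: Ig; rewrite linearB /= rescaleK // rmorphM rmorphXn.
Qed.

End Degeneration.

(** * Minimal generators *)

Section Generators.
Variables (K : fieldType) (n : nat).
Implicit Types (f g h : {mpoly K[n]}) (m : 'X_{1..n}).

Lemma mcoeffM_eq0 f g m :
  (forall m1 m2, m = (m1 + m2)%MM -> f@_m1 = 0 \/ g@_m2 = 0) -> (f * g)@_m = 0.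
Proof.
move=> H; rewrite mcoeffM big1 // => -[m1 m2] /= /eqP /H[->|->].
  exact: mul0r.
exact: mulr0.
Qed.

Lemma mnmU_or (k : 'I_n) m :
  (exists2 j, j != k & m j != 0%N) \/ m = (U_(k) *+ m k)%MM.
Proof.
have [/existsP[j /andP[jk mj]]|] := boolP [exists j, (j != k) && (m j != 0%N)].
  by left; exists j.
rewrite negb_exists => /forallP H; right; apply/mnmP => j.
rewrite mulmnE mnm1E; have := H j; rewrite negb_and !negbK eq_sym.
by case: eqP => [->|_] /=; rewrite ?mul1n ?mul0n // => /eqP.
Qed.

Variable I : {mpoly K[n]} -> Prop.

(* The coefficients of pure powers in the second hypothesis are functionals on
   I that vanish on the product of I with the irrelevant ideal, by the first
   hypothesis. Hence the h k form a basis modulo this product, and the matrix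
   writing them in terms of the generators is invertible at the origin. *)
Lemma generators_cofactor (g h : 'I_n -> {mpoly K[n]}) (p : 'I_n -> nat) :
  generated_by I g -> (forall k, I (h k)) ->
  (forall k s f, (s <= p k)%N -> I f -> f@_(U_(k) *+ s) = 0) ->
  (forall c : 'I_n -> K,
     (forall j, \sum_k c k * (h k)@_(U_(j) *+ (p j).+1) = 0) ->
     forall k, c k = 0) ->
  exists2 D, D@_0 != 0 & forall f, I f -> exists c, D * f = \sum_k c k * h k.
Proof.
move=> gen hI pure indep.
have [c hE] : exists c : 'I_n -> 'I_n -> {mpoly K[n]},
    forall k, h k = \sum_i c k i * g i.
  by apply: (fin_all_exists (P := fun k ck => h k = \sum_i ck i * g i)) => k;
    apply/gen.
have Ig i : I (g i).
  apply/gen; exists (fun j => (j == i)%:R); rewrite (bigD1 i) //= eqxx mul1r.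
  by rewrite big1 ?addr0 // => j /negPf ->; rewrite mul0r.
pose C : 'M[{mpoly K[n]}]_n := \matrix_(k, i) c k i.
exists (\det C) => [|f /gen[u ->]].
  have -> : (\det C)@_0 = \det (map_mx (mcoeff 0%MM) C) by rewrite det_map_mx.
  apply/negP => /det0P[v v0 vC].
  have [k vk] := row_neq0 v0; case/eqP: vk; move: k.
  (* At the origin the combination [v] of the rows of [C] is zero, so the [P i] have no constant
     term and [\sum_i P i * g i] lies in the product of [I] with the irrelevant ideal. *)
  apply: indep => j; pose P i := \sum_k v 0 k *: c k i.
  have P0 i : (P i)@_0 = 0.
    have := congr1 (fun w : 'rV_n => w 0 i) vC; rewrite /= !mxE => vCi.
    rewrite /P raddf_sum /= -[RHS]vCi; apply: eq_bigr => k _.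
    by rewrite mcoeffZ !mxE.
  have -> : \sum_k v 0 k * (h k)@_(U_(j) *+ (p j).+1) =
      (\sum_i P i * g i)@_(U_(j) *+ (p j).+1).
    under [in RHS]eq_bigr do rewrite /P mulr_suml.
    rewrite exchange_big raddf_sum /=; apply: eq_bigr => k _.
    rewrite -mcoeffZ hE scaler_sumr; congr mcoeff; apply: eq_bigr => i _.
    by rewrite scalerAl.
  rewrite raddf_sum big1 //= => i _; apply: mcoeffM_eq0 => m1 m2 Em.
  have [->|m10] := eqVneq m1 0%MM; [by left|right].
  have m2E : m2 = (U_(j) *+ m2 j)%MM.
    case: (mnmU_or j m2) => // -[k kj]; case/eqP.
    have := congr1 (fun m => m k) Em.
    by rewrite mulmnE mnm1E mnmDE eq_sym (negPf kj) mul0n; lia.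
  rewrite m2E; apply: pure => //.
  have := congr1 (fun m => m j) Em; rewrite mulmnE mnm1E mnmDE eqxx mul1n => Ej.
  have : m1 j != 0%N; last by lia.
  apply: contra m10 => /eqP m1j; apply/eqP; case: (mnmU_or j m1) => [[k kj]|->].
    case/eqP; have := congr1 (fun m => m k) Em.
    by rewrite mulmnE mnm1E mnmDE eq_sym (negPf kj) mul0n; lia.
  by rewrite m1j mulm0n.
exists (fun k => \sum_i u i * (\adj C) i k).
(* Cramer's rule: apply the adjugate of [C] to the expression of the [h k] in the generators. *)
have E i : \det C * g i = \sum_k (\adj C) i k * h k.
  transitivity ((\adj C *m (C *m \col_j g j)) i 0).
    by rewrite mulmxA mul_adj_mx mul_scalar_mx !mxE.
  rewrite mxE; apply: eq_bigr => k _; congr (_ * _).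
  by rewrite mxE hE; apply: eq_bigr => j _; rewrite !mxE.
rewrite mulr_sumr; under eq_bigr do rewrite mulrCA E mulr_sumr.
rewrite exchange_big /=; apply: eq_bigr => k _; rewrite mulr_suml.
by apply: eq_bigr => i _; rewrite mulrA.
Qed.

End Generators.

(** * Pure powers occurring in the annihilator of a binomial *)

Section PurePower.
Variables (K : fieldType) (n : nat).
Implicit Types (f g h : {mpoly K[n]}) (m : 'X_{1..n}).
Variables (a b : 'X_{1..n}) (c1 c2 : K).
Hypotheses (c1_neq0 : c1 != 0) (c2_neq0 : c2 != 0).
Local Notation I := (binomial_ann c1 a c2 b).
Variables (i0 j1 j2 : 'I_n).
Hypotheses (ab0 : (b i0 < a i0)%N) (j12 : j1 != j2).
Hypotheses (ab1 : (a j1 < b j1)%N) (ab2 : (a j2 < b j2)%N).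

Lemma pure_coeff0_leq (k : 'I_n) s r f :
  (forall f, I f -> f@_(U_(k) *+ s) = 0) -> (r <= s)%N -> I f ->
  f@_(U_(k) *+ r) = 0.
Proof.
move=> pure rs If; have idI := binomial_ann_ideal a b c1 c2.
have := pure _ (idealMl idI 'X_[U_(k) *+ (s - r)] If).
have -> : (U_(k) *+ s = U_(k) *+ (s - r) + U_(k) *+ r)%MM.
  by apply/mnmP => j; rewrite mnmDE !mulmnE -mulnDr subnK.
by rewrite mulrC mcoeffMX.
Qed.

(** [binomial_ann_coeff0] applies to whichever of [a], [b] is larger at [k]: the index [i0] is the
    obstruction for [a], and one of [j1], [j2] different from [k] is the obstruction for [b]. *)
Lemma pure_power_other k f : k != i0 -> I f ->
  f@_(U_(k) *+ maxn (a k) (b k)) = 0.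
Proof.
move=> ki If; case: (leqP (b k) (a k)) => ab.
  apply: (binomial_ann_coeff0 c1_neq0 If); first exact: mnmU_le.
  apply/mnm_lepP => /(_ i0); rewrite mnmDE mulmnE mnm1E (negPf ki) mul0n add0n.
  by rewrite leqNgt ab0.
apply: (binomial_ann_coeff0 c2_neq0 (binomial_annC If)); first exact: mnmU_le.
apply/mnm_lepP => le.
have [kj|kj] := eqVneq k j1.
  have := le j2; rewrite mnmDE mulmnE mnm1E kj (negPf j12) mul0n add0n.
  by rewrite leqNgt ab2.
have := le j1; rewrite mnmDE mulmnE mnm1E (negPf kj) mul0n add0n.
by rewrite leqNgt ab1.
Qed.

(** Otherwise the least pure power of ['X_i0] occurring in an element [f0] of [I] has exponent
    [q.+1] with [q > b i0]. Up to a cofactor [D], the form [f0] and pure powers of the other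
    variables generate [I]. The monomial [z] with exponents [p] would lie in [I], but comparing
    coefficients in [D * 'X_[z]] forces [D@_0 = 0]. *)
Lemma binomial_ann_pure_power (g : 'I_n -> {mpoly K[n]}) : generated_by I g ->
  exists2 f, I f & f@_(U_(i0) *+ (b i0).+1) != 0.
Proof.
move=> gen; have idI := binomial_ann_ideal a b c1 c2.
have [//|nex] := classic (exists2 f, I f & f@_(U_(i0) *+ (b i0).+1) != 0).
have vanb f : I f -> f@_(U_(i0) *+ (b i0).+1) = 0.
  by move=> If; apply/eqP; apply: contra_notT nex => nz; exists f.
pose Q s := exists2 f, I f & f@_(U_(i0) *+ s) != 0.
have [q [[f0 If0 f0q] minq]] : exists q, Q q /\ forall s, (s < q)%N -> ~ Q s.
  have : Q (a i0).+1.
    exists 'X_[U_(i0) *+ (a i0).+1]; last by rewrite mcoeffX eqxx oner_neq0.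
    apply: binomial_annX; apply/mnm_lepP => /(_ i0);
      by rewrite mulmnE mnm1E eqxx mul1n; lia.
  elim/ltn_ind: (a i0).+1 => s IH Qs.
  have [[r rs Qr]|nQ] := classic (exists2 r, (r < s)%N & Q r); first exact: IH Qr.
  by exists s; split=> // r rs Qr; apply: nQ; exists r.
have van s f : (s < q)%N -> I f -> f@_(U_(i0) *+ s) = 0.
  by move=> sq If; apply/eqP/negPn/negP => nz; case: (minq s sq); exists f.
case: q => [|q] in f0q minq van *.
  by move: f0q; rewrite (pure_coeff0_leq vanb) ?eqxx.
have bq : (b i0 < q)%N.
  rewrite ltnNge; apply/negP => qb; move: f0q.
  by rewrite (pure_coeff0_leq vanb) ?eqxx.
pose p k := if k == i0 then q else maxn (a k) (b k).
pose h k := if k == i0 then f0 else 'X_[U_(k) *+ (p k).+1].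
have Xp k j : k != i0 ->
    ('X_[U_(k) *+ (p k).+1] : {mpoly K[n]})@_(U_(j) *+ (p j).+1) = (k == j)%:R.
  move=> ki; rewrite mcoeffX; congr (_ %:R); congr nat_of_bool.
  apply/eqP/eqP => [/(congr1 (fun m => m k))|->//].
  by rewrite !mulmnE !mnm1E eqxx mul1n; case: eqP.
have [k|k s f sp If|c H k|D D0 DI] := @generators_cofactor _ _ _ g h p gen.
- rewrite /h; case: eqP => // /eqP ki; rewrite /p (negPf ki).
  apply: binomial_annX; apply/mnm_lepP => /(_ k);
    by rewrite mulmnE mnm1E eqxx mul1n; lia.
- move: sp; rewrite /p; case: eqP => [->|/eqP ki] sp; first by apply: van.
  by apply: pure_coeff0_leq sp If => f' If'; apply: pure_power_other.
- have c0 : c i0 = 0.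
    have := H i0; rewrite (bigD1 i0) //= big1 ?addr0 => [|k' ki].
      by rewrite /h /p eqxx => /eqP; rewrite mulf_eq0 (negPf f0q) orbF => /eqP.
    by rewrite /h (negPf ki) Xp // (negPf ki) mulr0.
  have [->//|ki] := eqVneq k i0.
  have := H k; rewrite (bigD1 k) //= big1 ?addr0 => [|k' kk].
    by rewrite /h (negPf ki) Xp // eqxx mulr1.
  have [->|ki'] := eqVneq k' i0; first by rewrite c0 mul0r.
  by rewrite /h (negPf ki') Xp // (negPf kk) mulr0.
(* [z] is not below [a] because of [j1], nor below [b] because [q > b i0]. *)
pose z := [multinom p k | k < n].
have Iz : I 'X_[z].
  apply: binomial_annX; apply/mnm_lepP => le.
    have := le j1; rewrite mnmE /p; case: eqP ab1 => [->|_]; last by lia.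
    by move: ab0; lia.
  by have := le i0; rewrite mnmE /p eqxx; lia.
have [c Ec] := DI _ Iz.
pose fr := f0 - f0@_(U_(i0) *+ q.+1) *: 'X_[U_(i0) *+ q.+1].
have frE m : fr@_m = if m == (U_(i0) *+ q.+1)%MM then 0 else f0@_m.
  rewrite /fr mcoeffB mcoeffZ mcoeffX eq_sym; case: eqP => [->|_].
    by rewrite mulr1 subrr.
  by rewrite mulr0 subr0.
have coefE m : (forall k, k != i0 -> (m k <= p k)%N) ->
    (D * 'X_[z])@_m = (c i0 * f0)@_m.
  move=> mp; rewrite Ec (bigD1 i0) //= mcoeffD raddf_sum /= big1 ?addr0.
    by rewrite /h eqxx.
  move=> k ki; rewrite /h (negPf ki) mulrC mcoeffXM; case: ifP => // /mnm_lepP/(_ k).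
  by rewrite mulmnE mnm1E eqxx mul1n; have := mp k ki; lia.
(* Induction on a weight where each other variable counts [q.+2], which outweighs the shift of the
   exponent of ['X_i0] by [q.+1]. The coefficient of [c i0 * f0] at the shifted monomial is zero,
   and apart from [(c i0)@_m] times a nonzero scalar all its contributions vanish by induction or by
   minimality of [q]. *)
have small N m : (q.+2 * (\sum_(k | k != i0) m k) + m i0 < N)%N ->
    (forall k, k != i0 -> (m k <= p k)%N) ->
    (exists2 k, k != i0 & (m k < p k)%N) -> (c i0)@_m = 0.
  elim: N m => // N IH m ltN mp [k ki mk].
  have mpM j : j != i0 -> ((m + U_(i0) *+ q.+1)%MM j <= p j)%N.
    by move=> ji; rewrite mnmDE mulmnE mnm1E eq_sym (negPf ji) mul0n addn0 mp.
  have := coefE _ mpM.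
  rewrite mulrC mcoeffXM; case: ifP => [/mnm_lepP/(_ k)|_].
    by rewrite mnmE mnmDE mulmnE mnm1E eq_sym (negPf ki) mul0n addn0 leqNgt mk.
  rewrite -[f0](subrK (f0@_(U_(i0) *+ q.+1) *: 'X_[U_(i0) *+ q.+1])) -/fr mulrDr.
  rewrite mcoeffD -scalerAr mcoeffZ addmC mcoeffMX mcoeffM_eq0 ?add0r.
    by move/esym/eqP; rewrite mulf_eq0 (negPf f0q) => /eqP.
  move=> m1 m2 Em; rewrite frE; case: eqP => [_|nm2]; first by right.
  have EmE j : j != i0 -> m j = (m1 j + m2 j)%N.
    move=> ji; have := congr1 (fun m => m j) Em.
    by rewrite !mnmDE mulmnE mnm1E eq_sym (negPf ji) mul0n.
  have Em0 : (q.+1 + m i0 = m1 i0 + m2 i0)%N.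
    have := congr1 (fun m => m i0) Em.
    by rewrite !mnmDE mulmnE mnm1E eqxx mul1n.
  have sumE : (\sum_(k | k != i0) m k =
      \sum_(k | k != i0) m1 k + \sum_(k | k != i0) m2 k)%N.
    by rewrite -big_split /=; apply: eq_bigr => j /EmE.
  have m1p : forall j, j != i0 -> (m1 j <= p j)%N.
    by move=> j ji; have := EmE j ji; have := mp j ji; lia.
  have m1k : exists2 j, j != i0 & (m1 j < p j)%N.
    by exists k => //; have := EmE k ki; lia.
  case: (mnmU_or i0 m2) => [[j ji mj]|m2E].
    left; apply: IH => //; rewrite sumE in ltN.
    have : (m2 j <= \sum_(k | k != i0) m2 k)%N by rewrite (bigD1 j) //= leq_addr.
    move: ltN; move: (\sum_(k | _) m1 k)%N (\sum_(k | _) m2 k)%N => s1 s2.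
    by move: mj Em0; nia.
  have [lt|] := ltnP (m2 i0) q.+1; first by right; rewrite m2E van.
  rewrite leq_eqVlt => /predU1P[E|lt]; first by case: nm2; rewrite m2E -E.
  left; apply: IH => //; rewrite sumE in ltN.
  move: ltN; move: (\sum_(k | _) m1 k)%N (\sum_(k | _) m2 k)%N => s1 s2.
  by move: lt Em0; nia.
(* At [z] the left side is [D@_0]. On the right, a monomial of [f0] involving another variable is
   handled by [small], and a pure power has exponent at most [q]. *)
have := coefE z; rewrite {1}mulrC mcoeffXM lepm_refl.
have -> : (z - z = 0)%MM by apply/mnmP => k; rewrite mnmBE subnn mnm0E.
rewrite mcoeffM_eq0 => [H|m1 m2 Em].
  by case/eqP: D0; apply: H => k _; rewrite mnmE.
have EmE j : p j = (m1 j + m2 j)%N.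
  by have := congr1 (fun m : 'X_{1..n} => m j) Em; rewrite /= mnmE mnmDE.
case: (mnmU_or i0 m2) => [[j ji mj]|->]; [left|right].
  apply: (small _ _ (ltnSn _)) => [k _|]; first by rewrite EmE leq_addr.
  by exists j => //; rewrite EmE; lia.
by apply: van => //; have := EmE i0; rewrite {1}/p eqxx; lia.
Qed.

End PurePower.

(** * The strong Lefschetz property *)

Section BinomialLefschetz.
Variables (K : fieldType) (n : nat).
Hypothesis charK : [pchar K] =i pred0.
Implicit Types (f g h l : {mpoly K[n]}) (a b m w : 'X_{1..n}).

Lemma mcoeff_homogenization M (i j : 'I_n) (r : {poly K}) m : i != j ->
  (homogenization M ('X_i : {mpoly K[n]}) 'X_j r)@_m =
  if (m == U_(i) *+ (M - m j) + U_(j) *+ m j)%MM && (m j <= M)%N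
  then r`_(m j) else 0.
Proof.
move=> ij; rewrite /homogenization raddf_sum /=.
have E (s : 'I_M.+1) : (r`_s *: ('X_i ^+ (M - s) * 'X_j ^+ s : {mpoly K[n]}))@_m =
    r`_s * (U_(i) *+ (M - s) + U_(j) *+ s == m)%MM%:R.
  by rewrite mcoeffZ !mpolyXn -mpolyXD mcoeffX.
have sE (s : nat) : (U_(i) *+ (M - s) + U_(j) *+ s)%MM = m -> s = m j.
  by move=> <-; rewrite mnmDE !mulmnE !mnm1E eqxx (negPf ij) mul0n mul1n.
under eq_bigr do rewrite E.
case: ifP => [/andP[/eqP mE mM]|nm].
  rewrite (bigD1 (Ordinal (mM : (m j < M.+1)%N))) //= (introT eqP (esym mE)) mulr1.
  rewrite big1 ?addr0 // => s; rewrite -val_eqE /= => ne.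
  case: eqP => [/sE sm|_]; last exact: mulr0.
  by rewrite sm eqxx in ne.
rewrite big1 // => s _; case: eqP => [mE|_]; last exact: mulr0.
have sm := sE _ mE; move: nm; rewrite -sm mE eqxx /=.
by rewrite -ltnS ltn_ord.
Qed.

(** * Binomials whose exponents differ in two variables only *)

Section TwoVariables.
Variables (a b : 'X_{1..n}) (c1 c2 : K) (i j : 'I_n).
Hypotheses (abi : (b i < a i)%N) (abj : (a j < b j)%N).
Hypothesis eq_ab : forall k, k != i -> k != j -> a k = b k.
Hypothesis deg_ab : (a i + a j = b i + b j)%N.
Local Notation I := (binomial_ann c1 a c2 b).

Lemma two_variables_neq : i != j.
Proof. by apply: contraTneq abi => ->; rewrite -leqNgt ltnW. Qed.

(** Only exponents [w] that agree with [a] outside [i], [j] and have degree [s] in these two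
    variables give a condition, which is the hypothesis at [q = w j]. *)
Lemma homogenization_binomial_ann s (r : {poly K}) :
  (s <= a i + a j)%N -> (size r <= (a i + a j - s).+1)%N ->
  (forall q, (q <= s)%N -> c1 * (r * 'X^q)`_(a j) + c2 * (r * 'X^q)`_(b j) = 0) ->
  I (homogenization (a i + a j - s) 'X_i 'X_j r).
Proof.
move=> sd sr r0 w; have ij := two_variables_neq.
set M := (a i + a j - s)%N in sr *; set H := homogenization _ _ _ _.
pose G := [forall k, (k != i) ==> (k != j) ==> (w k == a k)] && (w i + w j == s)%N.
have cE (c : 'X_{1..n}) : (c i + c j = a i + a j)%N ->
    (forall k, k != i -> k != j -> c k = a k) ->
    shifted_coeff H c w = if G then (r * 'X^(w j))`_(c j) else 0.
  move=> dc cout; rewrite /shifted_coeff mcoeff_homogenization // coefMXn mnmBE.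
  have [|nG] := boolP G.
    move=> /andP[/forallP wout /eqP ws].
    have {}wout k : k != i -> k != j -> w k = a k.
      by move=> ki kj; have := wout k; rewrite ki kj => /eqP.
    case: ifP => [/mnm_lepP le|nle].
      have := le i; have := le j => lej lei.
      rewrite ltnNge lej /= (_ : (_ <= M)%N) ?andbT; last by rewrite /M; lia.
      case: eqP => // -[]; apply/mnmP => k.
      rewrite mnmBE mnmDE !mulmnE !mnm1E.
      have [<-|ki] := eqVneq i k.
        by rewrite [j == i]eq_sym (negPf ij) /= mul0n mul1n addn0 /M; lia.
      have [<-|kj] := eqVneq j k; first by lia.
      rewrite eq_sym in ki; rewrite eq_sym in kj.
      by rewrite cout // wout // subnn; lia.
    case: ltnP => // lej; rewrite nth_default //.
    apply: leq_trans sr _; rewrite ltnNge; apply: contraFN nle => leM.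
    apply/mnm_lepP => k; have [->|ki] := eqVneq k i; first by move: leM; rewrite /M; lia.
    have [->//|kj] := eqVneq k j.
    by rewrite wout ?cout.
  case: ifP => // /mnm_lepP le; case: ifP => // /andP[/eqP mE mM].
  case/negP: nG; apply/andP; split.
    apply/forallP => k; apply/implyP => ki; apply/implyP => kj.
    have := congr1 (fun m : 'X_{1..n} => m k) mE.
    rewrite /= mnmBE mnmDE !mulmnE !mnm1E ![_ == k]eq_sym (negPf ki) (negPf kj) !mul0n.
    by move/eqP; rewrite subn_eq0 -(cout k) // eqn_leq le.
  have := congr1 (fun m : 'X_{1..n} => m i) mE.
  rewrite /= mnmBE mnmDE !mulmnE !mnm1E eqxx [j == i]eq_sym (negPf ij) mul0n mul1n.
  by have := le i; have := le j; move: mM; rewrite /M => *; apply/eqP; lia.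
rewrite !cE //; last by move=> k ki kj; rewrite eq_ab.
case: ifP => [/andP[_ /eqP ws]|_]; last by rewrite !mulr0 addr0.
by apply: r0; rewrite -ws leq_addl.
Qed.

Lemma generically_two_variables :
  generically (fun t : K => Lefschetz_on I [set i; j] (a i + a j) ('X_i + t *: 'X_j)).
Proof.
have ij := two_variables_neq; have idI := binomial_ann_ideal a b c1 c2.
(* The moments of the two-variable binomial: in degree [a i + a j] a monomial is determined by its
   exponent of ['X_j]. *)
pose phi s := if s == a j then c1 else if s == b j then c2 else 0.
have phiE (q : {poly K}) : moment_functional (a i + a j) phi q =
    c1 * q`_(a j) + c2 * q`_(b j).
  have aj : (a j < (a i + a j).+1)%N by lia.
  have bj : (b j < (a i + a j).+1)%N by lia.
  rewrite /moment_functional (bigD1 (Ordinal aj)) //= {1}/phi eqxx; congr (_ + _).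
  rewrite (bigD1 (Ordinal bj)) /=; last by rewrite -val_eqE /=; lia.
  rewrite /phi eqxx [b j == _]eq_sym ltn_eqF // big1 ?addr0 // => s.
  by rewrite -!val_eqE /= => /andP[/negPf -> /negPf ->]; rewrite mul0r.
have Si : form_on [set i; j] 1 ('X_i : {mpoly K[n]}).
  by apply: form_onXU; rewrite !inE eqxx.
have Sj : form_on [set i; j] 1 ('X_j : {mpoly K[n]}).
  by apply: form_onXU; rewrite !inE eqxx orbT.
have degS (m : 'X_{1..n}) : (forall k, k \notin [set i; j] -> m k = 0%N) ->
    mdeg m = (m i + m j)%N.
  move=> Sm; rewrite mdegE (bigD1 i) //= (bigD1 j) 1?eq_sym //= big1 ?addn0 // => k.
  by move=> /andP[ki kj]; rewrite Sm // !inE negb_or ki.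
apply: genericallyW (generically_binary_Lefschetz charK phi (a i + a j)) => t Pt.
split=> [|M f dM|s f sd].
- by apply: form_onD => //; apply: form_onZ.
- apply: form_on_ind => [|||m dm Sm]; [exact: (ideal0 idI)|exact: (idealD idI)| |].
    by move=> c g; apply: (idealZ idI).
  have dm' := degS _ Sm; apply: binomial_annX; apply/mnm_lepP => le;
    by have := le i; have := le j; lia.
elim/form_on_ind => {f} [|f g|c f|m dm Sm].
- by exists 0; [exact: form_on0|rewrite mulr0 subr0; exact: (ideal0 idI)].
- move=> [f' Sf' If'] [g' Sg' Ig']; exists (f' + g'); first exact: form_onD.
  by rewrite mulrDr opprD addrACA; apply: (idealD idI).
- move=> [f' Sf' If']; exists (c *: f'); first exact: form_onZ.
  by rewrite -scalerAr -scalerBr; apply: (idealZ idI).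
have dm' := degS _ Sm; rewrite dm in dm'.
have sq : (size ('X^(m j) : {poly K})%R <= (a i + a j - s).+1)%N.
  by rewrite size_polyXn; lia.
have [c sc cP] := Pt s 'X^(m j) sd sq.
exists (homogenization s 'X_i 'X_j c); first exact: form_on_homogenization.
have eN : (a i + a j - s = a i + a j - s.*2 + s)%N by lia.
have XE : 'X_[m] = homogenization (a i + a j - s) 'X_i 'X_j 'X^(m j) :> {mpoly K[n]}.
  rewrite homogenizationXn; last by lia.
  rewrite !mpolyXn -mpolyXD; congr mpolyX; apply/mnmP => k.
  rewrite mnmDE !mulmnE !mnm1E; have [<-|ki] := eqVneq i k.
    by rewrite [j == i]eq_sym (negPf ij) /= mul0n mul1n addn0; lia.
  have [<-|kj] := eqVneq j k; first by rewrite /= mul0n mul1n.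
  by rewrite Sm // !inE negb_or ![k == _]eq_sym ki.
have sr : (size ((1 + t *: 'X) ^+ (a i + a j - s.*2) * c)%R <= (a i + a j - s).+1)%N.
  by rewrite eN; apply: size_linearXM.
rewrite XE -homogenization_linearX -homogenizationM ?size_linearX // -eN -linearB /=.
apply: homogenization_binomial_ann => [||q qs]; first by lia.
  by rewrite (leq_trans (size_polyD _ _)) // geq_max size_polyN sq.
by rewrite -phiE; apply: cP; rewrite size_polyXn.
Qed.

End TwoVariables.

Lemma exists_mnm_lt a b : mdeg a = mdeg b -> a != b -> exists i, (b i < a i)%N.
Proof.
move=> dab ab; apply/existsP; apply: contraNT ab; rewrite negb_exists.
move=> /forallP le; have {}le : (a <= b)%MM.
  by apply/mnm_lepP => i; rewrite leqNgt.
rewrite -(submK le); suff /eqP : mdeg (b - a) == 0%N.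
  by move/eqP; rewrite mdeg_eq0 => /eqP ->; rewrite add0m.
by rewrite mdeg_sub_le // dab subnn.
Qed.

Section Main.
Variables (a b : 'X_{1..n}) (c1 c2 : K) (d : nat).
Hypotheses (da : mdeg a = d) (db : mdeg b = d).
Local Notation I := (binomial_ann c1 a c2 b).

Lemma two_variables_Lefschetz (i j : 'I_n) : (b i < a i)%N -> (a j < b j)%N ->
  (forall k, k != i -> k != j -> a k = b k) -> exists l, Lefschetz_on I setT d l.
Proof.
move=> abi abj eq_ab; have idI := binomial_ann_ideal a b c1 c2.
have ij := two_variables_neq abi abj.
have degE (m : 'X_{1..n}) : mdeg m = (m i + m j + \sum_(k | k \notin [set i; j]) m k)%N.
  rewrite mdegE (bigD1 i) //= (bigD1 j) 1?eq_sym //= addnA; congr (_ + _)%N.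
  by apply: eq_bigl => k; rewrite !inE negb_or.
have sum_ab : (\sum_(k | k \notin [set i; j]) a k =
    \sum_(k | k \notin [set i; j]) b k)%N.
  by apply: eq_bigr => k; rewrite !inE negb_or => /andP[*]; apply: eq_ab.
have deg_ab : (a i + a j = b i + b j)%N.
  apply/eqP; rewrite -(eqn_add2r (\sum_(k | k \notin [set i; j]) a k)%N).
  by rewrite {2}sum_ab -!degE da db.
have [t tL] := generically_ex charK
  (generically_two_variables c1 c2 abi abj eq_ab deg_ab).
(* Outside [i] and [j] the exponents agree, so ['X_k ^+ (a k).+1] is in [I] and the socle degrees
   add up to [d]. *)
have [k|l] := Lefschetz_on_add_variables charK idI (e := a) tL.
  rewrite !inE negb_or => /andP[ki kj]; rewrite mpolyXn; apply: binomial_annX;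
    apply/mnm_lepP => /(_ k); rewrite mulmnE mnm1E eqxx mul1n ?(eq_ab k) //; lia.
by rewrite -degE da => lL; exists l.
Qed.

Hypotheses (c1_neq0 : c1 != 0) (c2_neq0 : c2 != 0).

Lemma pure_power_Lefschetz (i j1 j2 : 'I_n) (g : 'I_n -> {mpoly K[n]}) :
  generated_by I g -> (b i < a i)%N -> j1 != j2 ->
  (a j1 < b j1)%N -> (a j2 < b j2)%N -> exists l, Lefschetz_on I setT d l.
Proof.
move=> gen abi j12 ab1 ab2; have idI := binomial_ann_ideal a b c1 c2.
have [f If fi] := binomial_ann_pure_power c1_neq0 c2_neq0 abi j12 ab1 ab2 gen.
(* A second index [k] with [b k < a k] would prevent ['X_i ^+ a i], hence every lower power of
   ['X_i], from occurring in [I]; yet ['X_i ^+ (b i).+1] occurs in [f]. *)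
have le_ab k : k != i -> (a k <= b k)%N.
  move=> ki; rewrite leqNgt; apply: contra fi => abk; apply/eqP.
  apply: pure_coeff0_leq (abi) If => f' If'.
  apply: (binomial_ann_coeff0 c1_neq0 If'); first exact: mnmU_le.
  apply/mnm_lepP => /(_ k); rewrite mnmDE mulmnE mnm1E eq_sym (negPf ki) mul0n.
  by rewrite leqNgt abk.
(* Normalized so that ['X_i ^+ (b i).+1] has coefficient 1. The degeneration is used with [e = b],
   whose monomial complete intersection has socle degree [mdeg b = d]. *)
pose f' := pihomog mdeg (b i).+1 ((f@_(U_(i) *+ (b i).+1))^-1 *: f).
rewrite -db mdegE.
apply: (Lefschetz_on_degeneration charK (k0 := i) (f := f') idI).
- move=> k ki; rewrite mpolyXn; apply: binomial_annX;
    apply/mnm_lepP => /(_ k); rewrite mulmnE mnm1E eqxx mul1n;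
    by have := le_ab k ki; lia.
- exact: pihomogP.
- by rewrite mcoeff_pihomog mdegMn mdeg1 mul1n eqxx mcoeffZ mulVf.
- by apply: (binomial_ann_pihomog da db); apply: (idealZ idI).
move=> M h; rewrite -mdegE db => dM /form_onT.
exact: (binomial_ann_vanish c1 c2 da db).
Qed.

End Main.

Lemma binomial_Lefschetz a b c1 c2 d (g : 'I_n -> {mpoly K[n]}) :
  mdeg a = d -> mdeg b = d -> a != b -> c1 != 0 -> c2 != 0 ->
  generated_by (binomial_ann c1 a c2 b) g ->
  exists l, Lefschetz_on (binomial_ann c1 a c2 b) setT d l.
Proof.
move=> da db ab c1_neq0 c2_neq0 gen.
have [i abi] : exists i, (b i < a i)%N by apply: exists_mnm_lt ab; rewrite da.
have [j abj] : exists j, (a j < b j)%N.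
  by apply: exists_mnm_lt; rewrite ?da // eq_sym.
have [/existsP[j' /andP[jj' abj']]|uniqj] :=
  boolP [exists j', (j' != j) && (a j' < b j')%N].
  exact: (pure_power_Lefschetz da db c1_neq0 c2_neq0 gen abi jj' abj' abj).
have [/existsP[i' /andP[ii' abi']]|uniqi] :=
  boolP [exists i', (i' != i) && (b i' < a i')%N].
  have gen' : generated_by (binomial_ann c2 b c1 a) g.
    by move=> f; split=> [/binomial_annC/gen|/gen/binomial_annC].
  have [l [Tl vanish surj]] :=
    pure_power_Lefschetz db da c2_neq0 c1_neq0 gen' abj ii' abi' abi.
  exists l; split=> // [M f dM Tf|s f sd Tf].
    by apply: binomial_annC; apply: vanish Tf.
  by have [h Th Ih] := surj s f sd Tf; exists h => //; apply: binomial_annC.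
apply: (two_variables_Lefschetz c1 c2 da db abi abj) => k ki kj.
move: uniqj uniqi; rewrite !negb_exists => /forallP/(_ k) + /forallP/(_ k).
by rewrite ki kj /=; lia.
Qed.

End BinomialLefschetz.

Theorem theorem4p5 (K : closedFieldType) (n : nat)
    (charK0 : [pchar K] =i pred0)
    (F : {mpoly K[n]}) (d : nat)
    (homF : F \is d.-homog) (binF : size (msupp F) = 2%N)
    (ciF : artinian_CI_codim_n (Ann F)) :
  strong_Lefschetz_quot (Ann F).
Proof.
have [[g gen] _] := ciF.
have [a [b suppF]] : exists a b, msupp F = [:: a; b].
  by move: binF; case: (msupp F) => [|a [|b []]] // _; exists a, b.
have ab : a != b.
  by have := msupp_uniq F; rewrite suppF /= inE andbT.
have aF : a \in msupp F by rewrite suppF inE eqxx.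
have bF : b \in msupp F by rewrite suppF !inE eqxx orbT.
have AnnE f : Ann F f <-> binomial_ann F@_a a F@_b b f.
  by apply: Ann_binomial => // m; rewrite suppF.
have da : mdeg a = d := dhomog_mf homF aF.
have db : mdeg b = d := dhomog_mf homF bF.
have gen' : generated_by (binomial_ann F@_a a F@_b b) g.
  by move=> f; rewrite -AnnE; apply: gen.
have [l lL] := binomial_Lefschetz charK0 da db ab
  (etrans (esym (mcoeff_msupp F a)) aF) (etrans (esym (mcoeff_msupp F b)) bF) gen'.
have [l' [hl' SLP]] := strong_Lefschetz_of_Lefschetz_on da db lL.
exists l'; split=> // i k k_gt0; case: (SLP i k k_gt0) => [inj|surj].
  by left=> f hf; rewrite !AnnE; apply: inj.
right=> h hh; have [f [hf Ih]] := surj h hh.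
by exists f; split; rewrite ?AnnE.
Qed.
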